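(* Let $\mathbb{F}_m$ be the last field of a radical tower over $\mathbb{C}(\overline{x})=\mathbb{C}(x_1,\ldots,x_n)$ with generators $\overline{\delta}=(\delta_1,\ldots,\delta_m)$, and consider a PDE \[(\mathrm{A})\qquad F(x_1,\ldots,x_n,y,y_1(\overline{x}),\ldots,y_n(\overline{x}),y_{11}(\overline{x}),\ldots)=0,\] where $F$ is a polynomial in $y$ and its partial derivatives (up to some finite order) with coefficients in $\mathbb{F}_m$. Let $\overline{a}(\overline{x})$ be the tuple of its non-rational coefficients and $\mathcal{P}=(\overline{x},\overline{a}(\overline{x}))$, with associated radical variety $\mathcal{V}_{\mathcal{P}}$ and tower variety $\mathcal{V}_{\mathbb{T}}$. Suppose that $\mathcal{V}_{\mathbb{T}}$ is unirational (i.e. rationally parametrizable). Then: \begin{enumerate} \item $\mathcal{V}_{\mathcal{P}}$ is unirational. \item If $\mathcal{Q}(\overline{z})=(\overline{r}(\overline{z}),\overline{\delta}(\overline{r}(\overline{z})))$ is a rational parametrization of $\mathcal{V}_{\mathbb{T}}$, then the PDE \[(\mathrm{B})\qquad G(r_1(\overline{z}),\ldots,r_n(\overline{z}),Y(\overline{z}),Y_1(\overline{z}),\ldots,Y_n(\overline{z}),Y_{11}(\overline{z}),\ldots)=0,\quad Y(\overline{z})=y(\overline{r}(\overline{z})),\] obtained by applying the change $\overline{x}=\overline{r}(\overline{z})$ in $(\mathrm{A})$, is algebraic. \item Assume that $\mathcal{Q}(\overline{z})$ in the previous item is invertible and let $\overline{h}$ be its inverse. If $Y(\overline{z})$ is a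 solution of $(\mathrm{B})$, then $Y(\overline{h}(\overline{x},\overline{\delta}(\overline{x})))$ is a solution of $(\mathrm{A})$. \end{enumerate}
   Context: A radical tower over $\mathbb{C}(\overline{x})$ is a chain of fields $\mathbb{F}_0=\mathbb{C}(x_1,\ldots,x_n)\subseteq\dots\subseteq\mathbb{F}_{m}$ with $\mathbb{F}_i=\mathbb{F}_{i-1}(\delta_i)=\mathbb{F}_0(\delta_1,\ldots,\delta_i)$, where $\delta_i^{e_i}=\alpha_i\in\mathbb{F}_{i-1}$ and $e_i\in\mathbb{N}$ is positive. Elements of $\mathbb{F}_m$ are regarded as functions of $\overline{x}$ after a choice of branches of the radicals. The non-rational coefficients of (A) are the coefficients of $F$, as a polynomial in $y$ and its partial derivatives, that are not in $\mathbb{C}(\overline{x})$. The radical variety $\mathcal{V}_{\mathcal{P}}$ is the Zariski closure of the image of the (branch of the) function $\overline{x}\mapsto\mathcal{P}(\overline{x})=(\overline{x},\overline{a}(\overline{x}))$. The tower variety $\mathcal{V}_{\mathbb{T}}\subseteq\mathbb{C}^{n+m}$ is the Zariski closure of the image of $\psi\colon\overline{x}\mapsto(\overline{x},\overline{\delta}(\overline{x}))$. Both are irreducible algebraic varieties of dimension $n$. A rational parametrization of $\mathcal{V}_{\mathbb{T}}$ is a tuple of rational functions of $\overline{z}=(z_1,\ldots,z_n)$ defining a dominant rational map $\mathbb{C}^n\dashrightarrow\mathcal{V}_{\mathbb{T}}$; its first $n$ components are called $\overline{r}=(r_1,\ldots,r_n)$ and the remaining ones are denoted $\overline{\delta}(\overline{r}(\overline{z}))$,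 which fixes the meaning of the composite $a(\overline{r}(\overline{z}))$ for every $a\in\mathbb{F}_m$ (write $a$ as a rational function of $\overline{x},\overline{\delta}$ and substitute $\mathcal{Q}(\overline{z})$). It is invertible if it is birational onto $\mathcal{V}_{\mathbb{T}}$; its inverse is then a tuple $\overline{h}$ of rational functions on $\mathcal{V}_{\mathbb{T}}$ with $\overline{h}(\mathcal{Q}(\overline{z}))=\overline{z}$. Partial derivatives are denoted with subindices: $y_{i_1\ldots i_s}=\frac{\partial^s y}{\partial x_{i_1}\cdots\partial x_{i_s}}$, and similarly for $Y$ with respect to the $z_i$; equal mixed partials are identified. The equation (B) is obtained by replacing $\overline{x}$ by $\overline{r}(\overline{z})$ in the coefficients of $F$ and replacing the partial derivatives of $y$ evaluated at $\overline{r}(\overline{z})$ by their expressions as linear combinations of the partial derivatives of $Y$, obtained by repeated use of the chain rule: $(y_1(\overline r(\overline z)),\ldots,y_n(\overline r(\overline z)))^T=(J_{\overline{r}}^{T})^{-1}(Y_1(\overline z),\ldots,Y_n(\overline z))^T$, where $J_{\overline{r}}$ is the Jacobian matrix of $\overline{r}$ (invertible as $\mathcal{Q}$ is dominant), and iteratively for higher orders. The result is a polynomial expression in $Y$ and its partial derivatives with coefficients functions of $\overline{z}$. (B) is called algebraic if all these coefficients are rational functions of $\overline{z}$. *)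

(* Defs.v *)
From HB Require Import structures.
From mathcomp Require Import all_boot all_order all_algebra.
From mathcomp Require Export complex.
From mathcomp Require Import all_classical all_reals all_analysis.
(* The notations of mpoly.v clash with those of mathcomp-analysis. *)
From mathcomp Require Export -(notations) mpoly.
Import numFieldNormedType.Exports.
Import Order.TTheory GRing.Theory Num.Theory.

Set Implicit Arguments.
Unset Strict Implicit.
Unset Printing Implicit Defensive.

Local Open Scope ring_scope.
Local Open Scope classical_set_scope.

Definition multi_iter (T : Type) (n : nat) (op : 'I_n -> T -> T)
    (al : multinom n) (t : T) : T :=
  foldr (fun i => iter (al i) (op i)) t (enum 'I_n).

(* 'I_(njets n s) indexes the partial derivatives of order at most s of a
   function of n variables, mixed partials being identified. *)
Definition njets (n s : nat) : nat := #|{: bmultinom n s.+1}|.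

Definition jet_index (n s : nat) (i : 'I_(njets n s)) : multinom n :=
  bmnm (enum_val i).

Definition partial (K : numFieldType) (n : nat) (i : 'I_n)
    (f : 'rV[K]_n -> K) : 'rV[K]_n -> K :=
  fun x => 'D_(delta_mx 0 i) f x.

(* Over the complex numbers and on an open set this amounts to complex
   differentiability, by Cauchy's theorem. *)
Definition holomorphic_on (K : numFieldType) (n : nat) (D : set 'rV[K]_n)
    (f : 'rV[K]_n -> K) : Prop :=
  forall (s : seq 'I_n) (x : 'rV[K]_n), D x ->
    differentiable (foldr (@partial K n) f s) x.

Definition jet (K : numFieldType) (n s : nat) (f : 'rV[K]_n -> K)
    (x : 'rV[K]_n) : 'I_(njets n s) -> K :=
  fun i => multi_iter (@partial K n) (jet_index i) f x.

(* [a] is an element of a field [L] in which polynomials are interpreted by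
   [i]; it has value [v] at [w] when some fraction p/q representing it has a
   denominator that does not vanish at [w], and p(w)/q(w) = v. *)
Definition has_value (K : numFieldType) (N : nat) (L : fieldType)
    (i : mpoly N K -> L) (a : L) (w : 'rV[K]_N) (v : K) : Prop :=
  exists p q : mpoly N K,
    [/\ i q != 0, a = i p / i q, meval (w 0) q != 0 &
        v = meval (w 0) p / meval (w 0) q].

(* [value] is the junk value 0 where [a] is not [regular]. *)
Definition regular (K : numFieldType) (N : nat) (L : fieldType)
    (i : mpoly N K -> L) (a : L) (w : 'rV[K]_N) : Prop :=
  exists v, has_value i a w v.

Definition value (K : numFieldType) (N : nat) (L : fieldType)
    (i : mpoly N K -> L) (a : L) (w : 'rV[K]_N) : K :=
  xget 0 [set v | has_value i a w v].

Definition ratfun (K : numFieldType) (N : nat) : fieldType :=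
  {fraction (mpoly N K)}.

Definition rat_of_mpoly (K : numFieldType) (N : nat) (p : mpoly N K) :
  ratfun K N := tofrac p.

Definition ratmap_regular (K : numFieldType) (k N : nat)
    (Q : 'I_N -> ratfun K k) (z : 'rV[K]_k) : Prop :=
  forall j, regular (@rat_of_mpoly K k) (Q j) z.

Definition ratmap_value (K : numFieldType) (k N : nat)
    (Q : 'I_N -> ratfun K k) (z : 'rV[K]_k) : 'rV[K]_N :=
  \row_j value (@rat_of_mpoly K k) (Q j) z.

Definition zariski_closure (K : numFieldType) (N : nat) (S : set 'rV[K]_N) :
    set 'rV[K]_N :=
  [set w | forall p : mpoly N K,
     (forall u, S u -> meval (u 0) p = 0) -> meval (w 0) p = 0].

Definition rational_parametrization (K : numFieldType) (k N : nat)
    (V : set 'rV[K]_N) (Q : 'I_N -> ratfun K k) : Prop :=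
  zariski_closure [set ratmap_value Q z | z in ratmap_regular Q] = V.

Definition unirational (K : numFieldType) (k N : nat) (V : set 'rV[K]_N) :
    Prop :=
  exists Q : 'I_N -> ratfun K k, rational_parametrization V Q.

(* [h] is a rational map on [V] inverse to [Q].  Every rational function on
   the irreducible variety [V] is the restriction of a rational function of
   the ambient space whose domain meets [V]. *)
Definition birational_inverse (K : numFieldType) (k N : nat)
    (V : set 'rV[K]_N) (Q : 'I_N -> ratfun K k) (h : 'I_k -> ratfun K N) :
    Prop :=
  [/\ forall j, exists2 w, V w & regular (@rat_of_mpoly K N) (h j) w,
      forall z, ratmap_regular Q z -> ratmap_regular h (ratmap_value Q z) ->
        ratmap_value h (ratmap_value Q z) = z
    & forall w, V w -> ratmap_regular h w ->
        ratmap_regular Q (ratmap_value h w) ->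
        ratmap_value Q (ratmap_value h w) = w].

Inductive field_adjoin (L : fieldType) (S : set L) : set L :=
| field_adjoin_gen a : S a -> field_adjoin S a
| field_adjoin1 : field_adjoin S 1
| field_adjoinB a b :
    field_adjoin S a -> field_adjoin S b -> field_adjoin S (a - b)
| field_adjoinM a b :
    field_adjoin S a -> field_adjoin S b -> field_adjoin S (a * b)
| field_adjoinV a : field_adjoin S a -> field_adjoin S a^-1.

(* The field F_k of the tower, as a subset of F_m.  The generators are
   numbered from 0, so that F_k is generated by those of index < k. *)
Definition tower_level (K : numFieldType) (n m : nat) (L : fieldType)
    (base : ratfun K n -> L) (delta : 'I_m -> L) (k : nat) : set L :=
  field_adjoin (range base `|` [set delta j | j in [set j : 'I_m | (j < k)%N]]).

Record radical_tower (K : numFieldType) (n m : nat) := RadicalTower {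
  tower_field :> fieldType;
  tower_base : {rmorphism ratfun K n -> tower_field};
  tower_delta : 'I_m -> tower_field;
  tower_exp : 'I_m -> nat;
  tower_exp_gt0 : forall i, (0 < tower_exp i)%N;
  tower_radical : forall i : 'I_m,
    tower_level tower_base tower_delta i (tower_delta i ^+ tower_exp i);
  tower_top : forall a, tower_level tower_base tower_delta m a
}.

Definition tower_poly (K : numFieldType) (n m : nat) (T : radical_tower K n m)
    (P : mpoly (n + m) K) : T :=
  mmap (fun c => tower_base T (rat_of_mpoly (mpolyC n c)))
       (fun i => match fintype.split i with
                 | inl j => tower_base T (rat_of_mpoly (mpolyX K (mnm1 j)))
                 | inr j => tower_delta T j
                 end) P.

Definition tower_point (K : numFieldType) (n m : nat)
    (d : 'rV[K]_n -> 'rV[K]_m) (x : 'rV[K]_n) : 'rV[K]_(n + m) :=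
  row_mx x (d x).

(* A choice of branches: functions [d] on an open set [U] such that
   delta |-> d turns elements of F_m into functions, i.e. every polynomial
   relation between x and delta in F_m holds between the functions x and d.
   In particular d_i ^ e_i = alpha_i(x, d).  [U] need not be connected. *)
Record is_branch (K : numFieldType) (n m : nat) (T : radical_tower K n m)
    (U : set 'rV[K]_n) (d : 'rV[K]_n -> 'rV[K]_m) : Prop := IsBranch {
  branch_open : open U;
  branch_nonempty : U !=set0;
  branch_holomorphic : forall j, holomorphic_on U (fun x => d x 0 j);
  branch_relations : forall P : mpoly (n + m) K, tower_poly T P = 0 ->
    forall x, U x -> meval (tower_point d x 0) P = 0
}.

Definition tower_variety (K : numFieldType) (n m : nat) (U : set 'rV[K]_n)
    (d : 'rV[K]_n -> 'rV[K]_m) : set 'rV[K]_(n + m) :=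
  zariski_closure [set tower_point d x | x in U].

(* Variable number i stands for the derivative of the unknown function of
   multi-index [jet_index i]. *)
Definition diffpoly (L : fieldType) (n s : nat) : Type := mpoly (njets n s) L.

Definition nonrational_coeffs (K : numFieldType) (n m s : nat)
    (T : radical_tower K n m) (F : diffpoly T n s) : seq T :=
  [seq a <- [seq mcoeff u F | u <- msupp F] | ~~ `[< range (tower_base T) a >]].

Definition radical_variety (K : numFieldType) (n m s : nat)
    (T : radical_tower K n m) (U : set 'rV[K]_n) (d : 'rV[K]_n -> 'rV[K]_m)
    (F : diffpoly T n s) :
    set 'rV[K]_(n + size (nonrational_coeffs F)) :=
  let a := nonrational_coeffs F in
  zariski_closure
    [set row_mx x (\row_j value (tower_poly T) a`_j (tower_point d x))
       | x in [set x | U x /\ forall j : 'I_(size a),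
                         regular (tower_poly T) a`_j (tower_point d x)]].

Arguments radical_variety {K n m s T} U d F.

(* A PDE with coefficient functions: its coefficients at each point, and the
   set of points where these are defined *)
Record pde (K : numFieldType) (n s : nat) := PDE {
  pde_at : 'rV[K]_n -> mpoly (njets n s) K;
  pde_dom : set 'rV[K]_n
}.

Definition pde_solution (K : numFieldType) (n s : nat) (E : pde K n s)
    (D : set 'rV[K]_n) (f : 'rV[K]_n -> K) : Prop :=
  [/\ open D, holomorphic_on D f &
      forall x, D x -> pde_dom E x -> meval (jet f x) (pde_at E x) = 0].

Definition pde_algebraic (K : numFieldType) (n s : nat) (E : pde K n s) :
    Prop :=
  forall u : multinom (njets n s), exists c : ratfun K n,
    forall z, pde_dom E z ->
      has_value (@rat_of_mpoly K n) c z (mcoeff u (pde_at E z)).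

(* Coefficients are evaluated at a point w of the tower variety: at
   w = (x, delta(x)) this gives a(x), at w = Q(z) it gives a(r(z)). *)
Definition coeffs_regular (K : numFieldType) (n m s : nat)
    (T : radical_tower K n m) (F : diffpoly T n s) (w : 'rV[K]_(n + m)) :
    Prop :=
  forall u, regular (tower_poly T) (mcoeff u F) w.

Definition coeffs_value (K : numFieldType) (n m s : nat)
    (T : radical_tower K n m) (F : diffpoly T n s) (w : 'rV[K]_(n + m)) :
    mpoly (njets n s) K :=
  map_mpoly (fun a => value (tower_poly T) a w) F.

Definition pdeA (K : numFieldType) (n m s : nat) (T : radical_tower K n m)
    (U : set 'rV[K]_n) (d : 'rV[K]_n -> 'rV[K]_m) (F : diffpoly T n s) :
    pde K n s :=
  PDE (fun x => coeffs_value F (tower_point d x))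
      [set x | U x /\ coeffs_regular F (tower_point d x)].

Definition jacobian (K : numFieldType) (n : nat)
    (r : 'I_n -> 'rV[K]_n -> K) (z : 'rV[K]_n) : 'M[K]_n :=
  \matrix_(i, j) partial j (r i) z.

(* A family [c] of functions indexed by multi-indices stands for the linear
   combination \sum_be c_be(z) Y_be(z).  If this is g(r(z)), then
   (g_i(r(z)))_i = (J_r^T)^-1 (d/dz_j (g(r(z))))_j is [chain_step r i c]. *)
Definition chain_step (K : numFieldType) (n : nat)
    (r : 'I_n -> 'rV[K]_n -> K) (i : 'I_n)
    (c : multinom n -> 'rV[K]_n -> K) : multinom n -> 'rV[K]_n -> K :=
  fun be z => \sum_j invmx (jacobian r z)^T i j *
    (partial j (c be) z +
     (if (0 < be j)%N then c (mnm_sub be (mnm1 j)) z else 0)).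

(* The coefficients expressing y_al(r(z)) through the Y_be(z) *)
Definition chain_coeff (K : numFieldType) (n : nat)
    (r : 'I_n -> 'rV[K]_n -> K) (al : multinom n) :
    multinom n -> 'rV[K]_n -> K :=
  multi_iter (chain_step r) al (fun be _ => (be == mnm0)%:R).

Definition chain_form (K : numFieldType) (n s : nat)
    (r : 'I_n -> 'rV[K]_n -> K) (z : 'rV[K]_n) (al : multinom n) :
    mpoly (njets n s) K :=
  \sum_i chain_coeff r al (jet_index i) z *: mpolyX K (mnm1 i).

Definition param_r (K : numFieldType) (n m : nat)
    (Q : 'I_(n + m) -> ratfun K n) : 'I_n -> 'rV[K]_n -> K :=
  fun i => value (@rat_of_mpoly K n) (Q (lshift m i)).

Definition pdeB (K : numFieldType) (n m s : nat) (T : radical_tower K n m)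
    (Q : 'I_(n + m) -> ratfun K n) (F : diffpoly T n s) : pde K n s :=
  PDE (fun z => mmap (@mpolyC (njets n s) K)
                     (fun i => chain_form s (param_r Q) z (jet_index i))
                     (coeffs_value F (ratmap_value Q z)))
      [set z | [/\ ratmap_regular Q z, jacobian (param_r Q) z \in unitmx &
                   coeffs_regular F (ratmap_value Q z)]].

(* Main.v *)
(* Let I be the ideal of polynomial relations between x and delta in F_m.
   Since F_m is algebraic over C(x), every polynomial outside I divides a
   nonzero polynomial in x modulo I, and the latter cannot vanish on a nonempty
   open set.  Hence I is the vanishing ideal of the points (x, delta(x)), for x
   in any nonempty open part of the domain of the branch, and also that of the
   values of a rational parametrization Q.  Substituting Q therefore defines an
   embedding of F_m into C(z): the images of the coefficients of F parametrize
   the radical variety, and they are coefficients of (B); the other ingredients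
   of (B) are obtained from the rational r_i by differentiation and by inversion
   of the Jacobian matrix.

   For the last item put g(x) = h(x, delta(x)).  Where Q is regular at g(x) one
   has Q(g(x)) = (x, delta(x)), so that the Jacobian matrix of g inverts that of
   r and the chain rule expresses the partial derivatives of Y(g(x)) by exactly
   the formulas defining (B); here one needs that the partial derivatives of Y
   commute.  The remaining points x are limits of such points, because g is
   dominant, and there the equation follows by continuity. *)

From HB Require Import structures.
From mathcomp Require Import all_boot all_order all_algebra.
From mathcomp Require Import ring lra.
From mathcomp Require Import all_classical all_reals all_analysis.
Require Import Defs.
Import numFieldNormedType.Exports.
Import Order.TTheory GRing.Theory Num.Theory.

Set Implicit Arguments.
Unset Strict Implicit.
Unset Printing Implicit Defensive.

Local Open Scope ring_scope.
Local Open Scope classical_set_scope.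

(** * Elements of two fields represented by the same fractions *)

(** An element of F_m or of C(z) has no preferred denominator: one that represents it may vanish at
    a point where another does not. Every passage between fields, evaluation at a point included, is
    therefore the relation of being represented by the same fraction p/q of polynomials. This
    relation respects the field operations and is single-valued once the polynomials that vanish in
    the source vanish in the target, so the embedding of F_m into C(z) never has to be built as a
    function. The second obstacle is the symmetry of second derivatives. It is reduced to the real
    mean value theorem by restricting a complex function to real lines and taking real and imaginary
    parts; everything else holds over any [numFieldType]. *)

Section Transfer.
Variables (A : nzRingType) (L M : fieldType).
Variables (i : {rmorphism A -> L}) (j : {rmorphism A -> M}).

(* [has_value] is the case where [j] is the evaluation at a point, and the
   embedding of F_m into C(z) defined by a parametrization is another one. *)
Definition transfer (a : L) (c : M) : Prop :=
  exists p q, [/\ i q != 0, a = i p / i q, j q != 0 & c = j p / j q].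

Lemma transfer_image p : transfer (i p) (j p).
Proof. by exists p, 1; rewrite !rmorph1 !divr1 !oner_neq0. Qed.

Lemma transfer0 : transfer 0 0.
Proof. by rewrite -(rmorph0 i) -(rmorph0 j); exact: transfer_image. Qed.

Lemma transferD a b c e :
  transfer a c -> transfer b e -> transfer (a + b) (c + e).
Proof.
move=> [p [q [iq -> jq ->]]] [p' [q' [iq' -> jq' ->]]].
exists (p * q' + p' * q), (q * q').
by rewrite !rmorphD !rmorphM /= !mulf_neq0 ?addf_div.
Qed.

Lemma transferM a b c e :
  transfer a c -> transfer b e -> transfer (a * b) (c * e).
Proof.
move=> [p [q [iq -> jq ->]]] [p' [q' [iq' -> jq' ->]]].
exists (p * p'), (q * q').
by rewrite !rmorphM /= !mulf_neq0 ?mulf_div.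
Qed.

Lemma transferN a c : transfer a c -> transfer (- a) (- c).
Proof.
by move=> [p [q [iq -> jq ->]]]; exists (- p), q; rewrite !rmorphN !mulNr.
Qed.

Lemma transferB a b c e :
  transfer a c -> transfer b e -> transfer (a - b) (c - e).
Proof. by move=> ac be; apply: transferD => //; apply: transferN. Qed.

Lemma transferX a c k : transfer a c -> transfer (a ^+ k) (c ^+ k).
Proof.
move=> ac; elim: k => [|k IHk].
  by rewrite !expr0 -(rmorph1 i) -(rmorph1 j); exact: transfer_image.
by rewrite !exprS; apply: transferM.
Qed.

Lemma transfer_sum (I : Type) (r : seq I) (P : pred I) (a : I -> L)
    (c : I -> M) :
  (forall k, P k -> transfer (a k) (c k)) ->
  transfer (\sum_(k <- r | P k) a k) (\sum_(k <- r | P k) c k).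
Proof.
move=> H; elim/big_rec2: _ => [|k x y Pk]; first exact: transfer0.
by apply: transferD; apply: H.
Qed.

Lemma transfer_prod (I : Type) (r : seq I) (P : pred I) (a : I -> L)
    (c : I -> M) :
  (forall k, P k -> transfer (a k) (c k)) ->
  transfer (\prod_(k <- r | P k) a k) (\prod_(k <- r | P k) c k).
Proof.
move=> H; elim/big_rec2: _ => [|k x y Pk]; last by apply: transferM; apply: H.
by rewrite -(rmorph1 i) -(rmorph1 j); exact: transfer_image.
Qed.

Lemma transfer_mmap (K : nzRingType) (f : {rmorphism K -> A}) (k : nat)
    (a : 'I_k -> L) (c : 'I_k -> M) (P : mpoly k K) :
  (forall l, transfer (a l) (c l)) ->
  transfer (mmap (fun x => i (f x)) a P) (mmap (fun x => j (f x)) c P).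
Proof.
move=> ac; apply: transfer_sum => u _.
apply: transferM; first exact: transfer_image.
by apply: transfer_prod => l _; apply: transferX.
Qed.

Hypothesis ker_sub : forall p, i p = 0 -> j p = 0.

Lemma transferV a c : transfer a c -> c != 0 -> transfer a^-1 c^-1.
Proof.
move=> [p [q [iq -> jq ->]]]; rewrite mulf_eq0 invr_eq0 negb_or => /andP[jp _].
exists q, p; rewrite !invf_div; split=> //.
by apply: contra jp => /eqP /ker_sub ->.
Qed.

Lemma transfer_eq0 c : transfer 0 c -> c = 0.
Proof.
move=> [p [q [iq /esym/eqP + jq ->]]].
rewrite mulf_eq0 invr_eq0 (negbTE iq) orbF => /eqP /ker_sub ->.
by rewrite mul0r.
Qed.

(** The difference of two images of [a] is an image of 0, and a fraction representing 0 has its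
    numerator in the kernel of [i], hence in that of [j]. *)
Lemma transfer_uniq a c e : transfer a c -> transfer a e -> c = e.
Proof.
move=> ac ae; apply/eqP; rewrite -subr_eq0; apply/eqP/transfer_eq0.
by rewrite -(subrr a); apply: transferB.
Qed.

End Transfer.

Lemma transfer_sym (A : nzRingType) (L M : fieldType)
    (i : {rmorphism A -> L}) (j : {rmorphism A -> M}) a c :
  transfer i j a c -> transfer j i c a.
Proof. by move=> [p [q [? ? ? ?]]]; exists p, q. Qed.

(** The fraction that represents [a] and [v] also represents [c]: its denominator is nonzero under
    [j] because it is nonzero under [k], and single-valuedness identifies its image with [c]. *)
Lemma transfer_comp (A : nzRingType) (L M N : fieldType)
    (i : {rmorphism A -> L}) (j : {rmorphism A -> M}) (k : {rmorphism A -> N})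
    (ker_sub : forall p, i p = 0 -> j p = 0) a c v :
  transfer i j a c -> transfer i k a v ->
  (forall q, j q = 0 -> k q = 0) -> transfer j k c v.
Proof.
move=> ac [p [q [iq E kq ->]]] jk.
have jq : j q != 0 by apply: contra kq => /eqP /jk ->.
exists p, q; split=> //.
by apply: (transfer_uniq ker_sub ac); exists p, q.
Qed.

HB.instance Definition _ (K : numFieldType) (N : nat) :=
  GRing.RMorphism.copy (@rat_of_mpoly K N) (@tofrac (mpoly N K)).

Section TowerPoly.
Variables (K : numFieldType) (n m : nat) (T : radical_tower K n m).

Let tower_scalar : {rmorphism K -> T} :=
  tower_base T \o @rat_of_mpoly K n \o @mpolyC n K.

Lemma tower_poly_is_zmod_morphism : zmod_morphism (tower_poly T).
Proof. exact: (@mmap_is_additive _ _ _ _ tower_scalar). Qed.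

Lemma tower_poly_is_monoid_morphism : monoid_morphism (tower_poly T).
Proof.
have [mulT oneT] := @mmap_is_multiplicative _ _ T
  (fun i => match fintype.split i with
            | inl j => tower_base T (rat_of_mpoly (mpolyX K (mnm1 j)))
            | inr j => tower_delta T j
            end) tower_scalar.
by split.
Qed.

HB.instance Definition _ := GRing.isZmodMorphism.Build _ _ (tower_poly T)
  tower_poly_is_zmod_morphism.
HB.instance Definition _ := GRing.isMonoidMorphism.Build _ _ (tower_poly T)
  tower_poly_is_monoid_morphism.
End TowerPoly.

(** * Values at points and vanishing ideals *)

Section Specialization.
Variables (K : numFieldType) (N : nat) (L : fieldType).
Variable i : {rmorphism mpoly N K -> L}.

(** Evaluation at [w] factors through the image of [i], which is what makes values at [w] unique. *)
Definition specializes (w : 'rV[K]_N) : Prop :=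
  forall p, i p = 0 -> meval (w 0) p = 0.

Definition vanishing_ideal (S : set 'rV[K]_N) : Prop :=
  forall p, i p = 0 <-> forall w, S w -> meval (w 0) p = 0.

(* A fraction representing [a] is [transfer]red to itself. *)
Definition is_fraction (a : L) : Prop := transfer i i a a.

Lemma has_valueE a w v : has_value i a w v = transfer i (meval (w 0)) a v.
Proof. by []. Qed.

Lemma has_value_uniq a w v v' :
  specializes w -> has_value i a w v -> has_value i a w v' -> v = v'.
Proof. by move=> ws; apply: transfer_uniq. Qed.

Lemma value_eq a w v : specializes w -> has_value i a w v -> value i a w = v.
Proof.
move=> ws av; apply: (has_value_uniq ws _ av).
by apply: (xgetPex 0 (P := [set v | has_value i a w v])); exists v.
Qed.

Lemma regular_value a w : regular i a w -> has_value i a w (value i a w).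
Proof.
by move=> [v av]; apply: (xgetPex 0 (P := [set v | has_value i a w v])); exists v.
Qed.

Lemma vanishing_ideal_specializes S w :
  vanishing_ideal S -> S w -> specializes w.
Proof. by move=> iS Sw p /iS; apply. Qed.

Lemma vanishing_ideal_nonzero S p : vanishing_ideal S -> i p != 0 ->
  exists2 w, S w & meval (w 0) p != 0.
Proof.
move=> iS /eqP ip; apply: contrapT => H; apply: ip; apply/iS => w Sw.
by apply/eqP/negPn/negP => pw; apply: H; exists w.
Qed.

Lemma mmap_meval k (w : 'rV[K]_N) (v : 'I_k -> K) P :
  mmap (fun x => meval (w 0) (@mpolyC N K x)) v P = meval v P.
Proof. by rewrite mevalE; apply: eq_bigr => u _; rewrite mevalC. Qed.

Lemma has_value_mmap k (a : 'I_k -> L) w (v : 'I_k -> K) P :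
  (forall l, has_value i (a l) w (v l)) ->
  has_value i (mmap (fun x => i (@mpolyC N K x)) a P) w (meval v P).
Proof.
by move=> av; rewrite -(mmap_meval w) has_valueE; exact: transfer_mmap.
Qed.

Lemma is_fraction_transfer (M : fieldType) (j : {rmorphism mpoly N K -> M}) a :
  (forall p, j p = 0 -> i p = 0) -> is_fraction a -> exists c, transfer i j a c.
Proof.
move=> ji [p [q [iq aE _ _]]]; exists (j p / j q), p, q; split=> //.
by apply: contra iq => /eqP /ji ->.
Qed.

(* The relations between the [a l] are those between their values: a common
   denominator shows that all of them are regular on a generic part of [S]. *)
Lemma vanishing_ideal_values S k (a : 'I_k -> L) P :
  vanishing_ideal S -> (forall l, is_fraction (a l)) ->
  mmap (fun x => i (@mpolyC N K x)) a P = 0 <->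
  forall w, S w -> (forall l, regular i (a l) w) ->
    meval (fun l => value i (a l) w) P = 0.
Proof.
move=> iS fr; split=> [aP w Sw reg|H].
  have ws := vanishing_ideal_specializes iS Sw.
  have := has_value_mmap P (fun l => regular_value (reg l)).
  by rewrite aP; exact: transfer_eq0.
apply/eqP/negPn/negP => aP0.
have [p [q [iq aPE _ _]]] : is_fraction (mmap (fun x => i (@mpolyC N K x)) a P).
  exact: transfer_mmap.
have /choice[pq pqP] l : exists pq : mpoly N K * mpoly N K,
    i pq.2 != 0 /\ a l = i pq.1 / i pq.2.
  by have [p' [q' [iq' -> _ _]]] := fr l; exists (p', q').
have ip : i p != 0 by apply: contra aP0 => /eqP ip; rewrite aPE ip mul0r.
(* A point where this product is nonzero makes every [a l] regular, and the fraction p/q for the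
   relation both defined and nonzero. *)
have iE : i (p * q * \prod_l (pq l).2) != 0.
  rewrite !rmorphM rmorph_prod !mulf_neq0 //.
  by apply/prodf_neq0 => l _; have [] := pqP l.
have [w Sw] := vanishing_ideal_nonzero iS iE.
rewrite !rmorphM rmorph_prod !mulf_eq0 !negb_or -andbA.
move=> /and3P[pw qw /prodf_neq0 pqw].
have reg l : regular i (a l) w.
  exists (meval (w 0) (pq l).1 / meval (w 0) (pq l).2), (pq l).1, (pq l).2.
  by have [? ?] := pqP l; split=> //; apply: pqw.
have ws := vanishing_ideal_specializes iS Sw.
have := has_value_mmap P (fun l => regular_value (reg l)).
rewrite H // => b0.
have bpq : has_value i (mmap (fun x => i (@mpolyC N K x)) a P) w
    (meval (w 0) p / meval (w 0) q) by exists p, q.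
have /eqP := has_value_uniq ws bpq b0.
by rewrite mulf_eq0 invr_eq0 (negbTE pw) (negbTE qw).
Qed.

End Specialization.

Lemma zariski_closure_sub (K : numFieldType) N (S : set 'rV[K]_N) :
  S `<=` zariski_closure S.
Proof. by move=> w Sw p; apply. Qed.

Lemma zariski_closure_vanishing (K : numFieldType) N (S : set 'rV[K]_N) p :
  (forall w, zariski_closure S w -> meval (w 0) p = 0) <->
  (forall w, S w -> meval (w 0) p = 0).
Proof.
split=> H w Sw; first by apply: H; exact: zariski_closure_sub.
exact: Sw.
Qed.

Lemma eq_zariski_closure (K : numFieldType) N (S S' : set 'rV[K]_N) :
  zariski_closure S = zariski_closure S' <->
  forall p, (forall w, S w -> meval (w 0) p = 0) <->
            (forall w, S' w -> meval (w 0) p = 0).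
Proof.
split=> [E p|E]; first by rewrite -(zariski_closure_vanishing S) E
  zariski_closure_vanishing.
by apply/seteqP; split=> w Sw p Sp; apply: Sw; apply/E.
Qed.

(** A representative of the class supplies numerator and denominator; the equality is checked in the
    quotient by cross-multiplication. *)
Lemma fractionP (R : idomainType) (a : {fraction R}) :
  exists p q, q != 0 /\ a = tofrac p / tofrac q :> {fraction R}.
Proof.
elim/quotW: a => x; have dx := denom_ratioP x.
exists (frac x).1, (frac x).2; split=> //.
apply: (canRL (mulfK _)); first by rewrite tofrac_eq0.
unlock tofrac; rewrite -[LHS]FracField.pi_mul; apply/eqmodP.
rewrite /= FracField.equivfE !numden_Ratio ?mulr1 ?oner_neq0 ?mulf_neq0 //.
by rewrite mulrC.
Qed.

Section RationalFunctions.
Variables (K : numFieldType) (N : nat).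

Lemma rat_of_mpoly_eq0 (p : mpoly N K) : (rat_of_mpoly p == 0) = (p == 0).
Proof. exact: tofrac_eq0. Qed.

Lemma rat_specializes (w : 'rV[K]_N) : specializes (@rat_of_mpoly K N) w.
Proof.
by move=> p /eqP; rewrite rat_of_mpoly_eq0 => /eqP ->; rewrite meval0.
Qed.

Lemma rat_is_fraction (a : ratfun K N) : is_fraction (@rat_of_mpoly K N) a.
Proof.
have [p [q [q0 ->]]] := fractionP a.
by exists p, q; rewrite rat_of_mpoly_eq0.
Qed.

End RationalFunctions.

(** * Algebraicity of the tower over C(x) *)

Section Algebraic.
Variables (K : numFieldType) (n m : nat) (T : radical_tower K n m).

(** Induction on the level: a polynomial annihilating the radicand of delta_j, composed with a power
    of X, annihilates delta_j, and algebraic elements are closed under the field operations. *)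
Lemma tower_algebraic (a : T) : algebraicOver (tower_base T) a.
Proof.
suff H k : (k <= m)%N -> forall b,
    tower_level (tower_base T) (tower_delta T) k b ->
    algebraicOver (tower_base T) b.
  exact: H (leqnn m) _ (tower_top a).
elim/ltn_ind: k => k IHk km b; elim=> {b}.
- move=> b [[c _ <-]|[j /= jk <-]]; first exact: algebraic_id.
  have [p p0 rp] := IHk _ jk (ltnW (ltn_ord j)) _ (tower_radical T j).
  exists (p \Po 'X^(tower_exp T j)).
    (* Positivity of the exponent matters: composition with X^0 could yield the zero polynomial. *)
    by rewrite comp_poly_eq0 ?size_polyXn // ltnS tower_exp_gt0.
  by rewrite map_comp_poly map_polyXn /root horner_comp hornerXn.
- exact: algebraic1.
- by move=> b c _ ? _ ?; apply: algebraic_sub.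
- by move=> b c _ ? _ ?; apply: algebraic_mul.
- by move=> b _ ?; apply: algebraic_inv.
Qed.

(** Factors X are stripped from an annihilating polynomial until its constant term [c] is nonzero;
    then a q(a) = -c, and the inverse of [a] is -q(a)/c. *)
Lemma algebraic_inv_horner (F E : fieldType) (f : {rmorphism F -> E}) a :
  a != 0 -> algebraicOver f a -> exists r, a^-1 = (map_poly f r).[a].
Proof.
move=> a0 [q q0 /eqP]; elim/poly_ind: q q0 => [|q c IHq]; first by rewrite eqxx.
rewrite rmorphD rmorphM /= map_polyX map_polyC /= hornerMXaddC.
have [->|c0] := eqVneq c 0.
  rewrite addr0 mulf_eq0 polyX_eq0 orbF rmorph0 addr0 => q0 /eqP.
  by rewrite mulf_eq0 (negbTE a0) orbF => /eqP; exact: IHq.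
move=> _ /eqP; rewrite addr_eq0 => /eqP qa; exists (- c^-1 *: q).
rewrite map_polyZ hornerZ rmorphN fmorphV /= -[_.[a]](mulfK a0) qa.
by rewrite !mulNr mulrN opprK mulrA mulVf ?fmorph_eq0 // mul1r.
Qed.

Lemma tower_poly_scalar (c : K) :
  tower_poly T (@mpolyC _ K c) = tower_base T (rat_of_mpoly (mpolyC n c)).
Proof.
exact: (@mmapC _ _ _ _ (tower_base T \o @rat_of_mpoly K n \o @mpolyC n K)).
Qed.

Lemma tower_polyX (l : 'I_(n + m)) : tower_poly T (mpolyX K (mnm1 l)) =
  match fintype.split l with
  | inl j => tower_base T (rat_of_mpoly (mpolyX K (mnm1 j)))
  | inr j => tower_delta T j
  end.
Proof.
rewrite /tower_poly.
rewrite (@mmapX _ _ _ _ (tower_base T \o @rat_of_mpoly K n \o @mpolyC n K)).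
by rewrite mmap1U.
Qed.

Definition lift_base (c : mpoly n K) : mpoly (n + m) K :=
  mmap (@mpolyC _ K) (fun l => mpolyX K (mnm1 (lshift m l))) c.

Lemma tower_poly_lift_base c :
  tower_poly T (lift_base c) = tower_base T (rat_of_mpoly c).
Proof.
rewrite /lift_base {2}(mpolyE c) !rmorph_sum; apply: eq_bigr => u _.
rewrite rmorphM /= tower_poly_scalar -mul_mpolyC !rmorphM; congr (_ * _).
rewrite mpolyXE_id !rmorph_prod; apply: eq_bigr => l _.
rewrite !rmorphXn /= tower_polyX (_ : fintype.split _ = inl l) //.
exact: (unsplitK (inl l)).
Qed.

Lemma meval_lift_base c (w : 'rV[K]_(n + m)) :
  meval (w 0) (lift_base c) = meval (lsubmx w 0) c.
Proof.
rewrite /lift_base rmorph_sum mevalE; apply: eq_bigr => u _.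
rewrite rmorphM /= mevalC; congr (_ * _); rewrite rmorph_prod.
by apply: eq_bigr => l _; rewrite rmorphXn /= mevalXU mxE.
Qed.

(** The fractions with denominator in C[x] form a ring that contains C(x) and the generators. The
    inverse of an algebraic element is a polynomial in it over C(x), so this ring is already the
    whole field. *)
Lemma tower_fraction (a : T) : exists P (c : mpoly n K),
  c != 0 /\ a = tower_poly T P / tower_base T (rat_of_mpoly c).
Proof.
have base0 (c : mpoly n K) : c != 0 -> tower_base T (rat_of_mpoly c) != 0.
  by rewrite fmorph_eq0 rat_of_mpoly_eq0.
pose S b := exists P (c : mpoly n K),
  c != 0 /\ b = tower_poly T P / tower_base T (rat_of_mpoly c).
have S_poly P : S (tower_poly T P).
  by exists P, 1; rewrite oner_neq0 !rmorph1 divr1.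
have SM b c : S b -> S c -> S (b * c).
  move=> [P [p [p0 ->]]] [Q [q [q0 ->]]]; exists (P * Q), (p * q).
  by rewrite mulf_neq0 // !rmorphM mulf_div.
have SB b c : S b -> S c -> S (b - c).
  move=> [P [p [p0 ->]]] [Q [q [q0 ->]]].
  exists (P * lift_base q - Q * lift_base p), (p * q).
  split; first by rewrite mulf_neq0.
  rewrite rmorphB !rmorphM /= !tower_poly_lift_base -[- (_ / _)]mulNr.
  by rewrite addf_div ?base0 // mulNr.
have S0 : S 0 by rewrite -(rmorph0 (tower_poly T)); exact: S_poly.
have SD b c : S b -> S c -> S (b + c).
  by move=> Sb Sc; rewrite -[c]opprK -[- c]sub0r; apply/SB/SB.
have S_base (c : ratfun K n) : S (tower_base T c).
  have [p [q [q0 -> _ _]]] := rat_is_fraction c; exists (lift_base p), q.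
  by rewrite -rat_of_mpoly_eq0 fmorph_div tower_poly_lift_base.
have S_horner b r : S b -> S (map_poly (tower_base T) r).[b].
  move=> Sb; elim/poly_ind: r => [|r c IHr]; first by rewrite rmorph0 horner0.
  rewrite rmorphD rmorphM /= map_polyX map_polyC /= hornerMXaddC.
  by apply: SD => //; apply: SM.
have := tower_top a; elim=> {a}.
- move=> b [[c _ <-]|[j _ <-]]; first exact: S_base.
  suff -> : tower_delta T j = tower_poly T (mpolyX K (mnm1 (rshift n j))).
    exact: S_poly.
  rewrite tower_polyX (_ : fintype.split _ = inr j) //.
  exact: (unsplitK (inr j)).
- by rewrite -(rmorph1 (tower_poly T)); exact: S_poly.
- by move=> b c _ ? _ ?; apply: SB.
- by move=> b c _ ? _ ?; apply: SM.
- move=> b _ Sb; have [->|b0] := eqVneq b 0; first by rewrite invr0.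
  have [r ->] := algebraic_inv_horner b0 (tower_algebraic b).
  exact: S_horner.
Qed.

Lemma tower_is_fraction (a : T) : is_fraction (tower_poly T) a.
Proof.
have [P [c [c0 ->]]] := tower_fraction a.
by exists P, (lift_base c); rewrite /= tower_poly_lift_base fmorph_eq0 rat_of_mpoly_eq0.
Qed.

(** Both witnesses come from writing the inverse of the image of [P] as P'/c. *)
Lemma tower_poly_multiple P : tower_poly T P != 0 ->
  exists P' (c : mpoly n K), c != 0 /\ tower_poly T (P * P' - lift_base c) = 0.
Proof.
move=> P0; have [P' [c [c0 E]]] := tower_fraction (tower_poly T P)^-1.
exists P', c; split=> //; apply/eqP.
rewrite rmorphB rmorphM /= tower_poly_lift_base subr_eq0.
rewrite -[X in _ == X](mulKf P0) E mulrCA divfK //.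
by rewrite fmorph_eq0 rat_of_mpoly_eq0.
Qed.

End Algebraic.

(** * Differentials and partial derivatives *)

Section Differentials.
Variable K : numFieldType.

Lemma differentiable_approx (V W : normedModType K) (f : V -> W) x e :
  differentiable f x -> 0 < e ->
  \forall v \near 0, `|f (v + x) - f x - 'd f x v| <= e * `|v|.
Proof.
move=> /diff_locally /eqaddoP H e0; have := H _ e0.
by apply: filterS => v; rewrite /= !fctE opprD addrA.
Qed.

(** The differential of [f] is a first-order approximation of [g] as well, and uniqueness of
    differentials identifies it with that of [g]. *)
Lemma near_eq_differentiable (V W : normedModType K) (f g : V -> W) x :
  {near x, f =1 g} -> differentiable f x -> differentiable g x.
Proof.
move=> fg df.
have gE : g \o shift x = cst (g x) + 'd f x +o_ 0 id.
  apply/eqaddoP => e e0.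
  have fg' : \forall v \near 0, f (v + x) = g (v + x).
    by move: fg; rewrite (near_shift 0) subr0.
  near=> v; rewrite /= !fctE opprD addrA -(nbhs_singleton fg).
  rewrite -(near fg' v) //; near: v.
  exact: differentiable_approx.
have cdf := diff_continuous df.
have E := diff_unique cdf gE.
by apply/diff_locallyP; rewrite E.
Unshelve. all: by end_near. Qed.

Lemma differentiable_rV (V : normedModType K) N (g : V -> 'rV[K]_N) x :
  (forall j, differentiable (fun y => g y 0 j) x) -> differentiable g x.
Proof.
move=> dg; have -> : g = \sum_j (fun y => g y 0 j *: delta_mx 0 j).
  by apply/funext => y; rewrite fct_sumE [LHS]row_sum_delta.
by apply: differentiable_sum => j; apply: differentiableZl.
Qed.

Lemma diff_coord (V : normedModType K) N (g : V -> 'rV[K]_N) x j v :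
  differentiable g x -> 'd (fun y => g y 0 j) x v = ('d g x v) 0 j.
Proof.
move=> dg; have dc := @differentiable_coord K 1 N (g x) 0 j.
have @c : {linear 'rV[K]_N -> K}.
  by exists (fun M : 'rV[K]_N => M 0 j); do 2![eexists]; do ?[constructor];
     rewrite ?mxE// => ? *; rewrite ?mxE//; move=> ?; rewrite !mxE.
have cc : continuous c by exact: coord_continuous.
by rewrite -[fun y => _]/(c \o g) diff_comp // diff_lin.
Qed.

Lemma differentiable_coord_comp (V : normedModType K) N (g : V -> 'rV[K]_N) x j :
  differentiable g x -> differentiable (fun y => g y 0 j) x.
Proof.
by move=> dg; apply: (differentiable_comp (g := fun M : 'rV[K]_N => M 0 j)) => //;
  exact: differentiable_coord.
Qed.

Lemma diff_partial n (f : 'rV[K]_n -> K) x v : differentiable f x ->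
  'd f x v = \sum_j v 0 j * partial j f x.
Proof.
move=> df; rewrite {1}(row_sum_delta v) linear_sum; apply: eq_bigr => j _.
by rewrite linearZ /= /partial deriveE.
Qed.

Lemma partial_comp n N (f : 'rV[K]_N -> K) (g : 'rV[K]_n -> 'rV[K]_N) i x :
  differentiable g x -> differentiable f (g x) ->
  partial i (f \o g) x =
  \sum_j partial j f (g x) * partial i (fun y => g y 0 j) x.
Proof.
move=> dg df; rewrite {1}/partial deriveE; last exact: differentiable_comp.
rewrite diff_comp //= diff_partial //; apply: eq_bigr => j _.
rewrite mulrC; congr (_ * _); rewrite /partial deriveE ?diff_coord //.
exact: differentiable_coord_comp.
Qed.

End Differentials.

(** With [c] the value of a function at a base point and [p], [q] parts of its differential there,
    this compares the difference of two values with [p] by means of two first-order errors. *)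
Lemma subr_cancel_common (A : comNzRingType) (a b c p q : A) :
  a - b - p = (a - c - (p + q)) - (b - c - q).
Proof. by ring. Qed.

(** A second difference is unchanged when its two increments are exchanged. *)
Lemma subr_swap (A : comNzRingType) (a b c d : A) :
  a - b - (c - d) = a - c - (b - d).
Proof. by ring. Qed.

(** * Commutation of partial derivatives over the complex numbers *)

Section RealPart.
Local Open Scope complex_scope.
Variable R : realType.
Local Notation C := (R[i] : numFieldType).

Lemma norm_real (h : R) : `|h%:C| = `|h|%:C :> C.
Proof. by rewrite normc_def /= expr0n addr0 sqrtr_sqr. Qed.

Lemma near_real (P : set C) :
  (\forall z \near (0 : C), P z) -> \forall h \near (0 : R), P h%:C.
Proof.
move=> /nbhs_ballP[e /= e0 eP]; apply/nbhs_ballP; exists (complex.Re e).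
  by move: e0; rewrite ltcE => /andP[].
move=> h; rewrite -!ball_normE /= !sub0r !normrN => he; apply: eP.
rewrite -ball_normE /= sub0r normrN norm_real ltcE /= he andbT.
by rewrite ger0_Im // ltW.
Qed.

(* [lam] is the real or the imaginary part. *)
Variables (V : normedModType C) (lam : C -> R).
Hypothesis lamB : forall a b, lam (a - b) = lam a - lam b.
Hypothesis lamZ : forall (h : R) a, lam (h%:C * a) = h * lam a.
Hypothesis lam_le : forall a, `|lam a|%:C <= `|a|.

(** Restriction to a real line followed by a real-linear functional gives a function to which the
    real mean value theorem applies. *)
Lemma is_derive_line (f : V -> C) x v (t : R) :
  differentiable f (x + t%:C *: v) ->
  is_derive t (1 : R) (fun s : R => lam (f (x + s%:C *: v)))
    (lam ('d f (x + t%:C *: v) v)).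
Proof.
set y := x + _ => df; set phi := fun s => _.
have H : h^-1 *: (phi (h *: 1 + t) - phi t) @[h --> (0 : R)^'] -->
    lam ('d f y v).
  apply/cvgrPdist_le => e e0.
  (* Adding 1 allows the division even when [v] is zero. *)
  have v1 : 0 < `|v| + 1 :> C by rewrite ltr_wpDl.
  have eps0 : 0 < e%:C / (`|v| + 1) :> C by rewrite divr_gt0 // ltcR.
  have A := near_real (near0Z v (differentiable_approx df eps0)).
  near=> h.
  have h0 : h != 0 by near: h; exact: nbhs_dnbhs_neq.
  have Ah : `|f (h%:C *: v + y) - f y - 'd f y (h%:C *: v)| <=
      e%:C / (`|v| + 1) * `|h%:C *: v|.
    by near: h; apply: nbhs_dnbhs.
  have -> : phi (h *: 1 + t) = lam (f (h%:C *: v + y)).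
    rewrite /phi /y; congr (lam (f _)).
    by rewrite [h *: 1]mulr1 rmorphD scalerDl addrCA.
  have -> : lam ('d f y v) - h^-1 *: (lam (f (h%:C *: v + y)) - phi t) =
      - (h^-1 * lam (f (h%:C *: v + y) - f y - 'd f y (h%:C *: v))).
    have -> : 'd f y (h%:C *: v) = h%:C * 'd f y v by rewrite linearZ.
    rewrite !lamB lamZ [h^-1 *: _]/(h^-1 * _).
    by rewrite [in RHS]mulrBr mulKf // opprB.
  rewrite normrN normrM normfV ler_pdivrMl ?normr_gt0 //.
  rewrite -lecR; apply: le_trans (lam_le _) _; apply: le_trans Ah _.
  rewrite normrZ norm_real rmorphM /= mulrCA ler_wpM2l ?ler0c //.
  by rewrite mulrAC ler_pdivrMr // ler_wpM2l ?ler0c ?ltW // ltrDl.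
split; last exact: cvg_lim H.
by apply/cvg_ex; exists (lam ('d f y v)).
Unshelve. all: by end_near. Qed.

(** The theorem is applied to the difference of [f] along two parallel segments, so that a single
    intermediate [c] serves both. *)
Lemma mean_value (f : V -> C) x v (h : R) : 0 < h ->
  (forall t : R, t \in `[0, h]%R -> differentiable f (x + t%:C *: v)) ->
  forall w, (forall t : R, t \in `[0, h]%R ->
    differentiable f (x + w + t%:C *: v)) ->
  exists2 c : R, c \in `]0, h[%R &
    lam (f (x + w + h%:C *: v) - f (x + h%:C *: v) - (f (x + w) - f x)) =
    h * lam ('d f (x + w + c%:C *: v) v - 'd f (x + c%:C *: v) v).
Proof.
move=> h0 df w dfw.
pose phi := (fun s : R => lam (f (x + w + s%:C *: v))) -
  (fun s : R => lam (f (x + s%:C *: v))).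
pose dphi (s : R) := lam ('d f (x + w + s%:C *: v) v) -
  lam ('d f (x + s%:C *: v) v).
have der t : t \in `[0, h]%R -> is_derive t (1 : R) phi (dphi t).
  move=> t0h; have ? := is_derive_line (df t t0h).
  by have ? := is_derive_line (dfw t t0h); exact: is_deriveB.
have cont : {within `[0, h], continuous phi}.
  apply: continuous_in_subspaceT => t; rewrite inE => t0h.
  have [dt _] := der t t0h.
  exact/differentiable_continuous/derivable1_diffP.
have der_oo t : t \in `]0, h[%R -> is_derive t (1 : R) phi (dphi t).
  by move=> th; apply: der; apply: subset_itv_oo_cc th.
have [c ch E] := @MVT R phi dphi 0 h h0 der_oo cont.
exists c => //; move: E; rewrite /phi /dphi subr0 mulrC -!lamB => <-.
by rewrite !fctE rmorph0 scale0r !addr0 -!lamB.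
Qed.

(* Young's form of the symmetry of second derivatives: the right-hand second
   difference is symmetric in [u] and [v], while [lam ('d ('D_u f) x v)] is not
   visibly so. *)
Lemma second_difference (f : V -> C) x u v e :
  (\forall y \near x, differentiable f y) -> differentiable ('D_u f) x ->
  0 < e -> \forall h \near (0 : R)^'+,
    `|lam (f (x + h%:C *: v + h%:C *: u) - f (x + h%:C *: u) -
           (f (x + h%:C *: v) - f x)) - h ^+ 2 * lam ('d ('D_u f) x v)|
    <= e * h ^+ 2.
Proof.
move=> df dF e0; set F := 'D_u f.
(* All points used below lie within h M of [x]. The factor 2 in the tolerance pays for the two
   first-order errors [A1] and [A2]. *)
pose M : C := `|u| + `|v| + 1.
have M0 : 0 < M by rewrite ltr_wpDl ?addr_ge0.
have eps0 : 0 < e%:C / (M *+ 2) :> C by rewrite divr_gt0 ?ltcR ?mulrn_wgt0.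
have := differentiable_approx dF eps0.
have : \forall w \near 0, differentiable f (w + x).
  by move: df; rewrite (near_shift 0) subr0.
move=> dfw apw; have : \forall w \near (0 : V), differentiable f (w + x) /\
    `|F (w + x) - F x - 'd F x w| <= e%:C / (M *+ 2) * `|w|.
  exact: filterI.
move=> /nbhs_ballP[d /= d0 dP].
have hd : \forall z \near (0 : C), `|z| * M < d.
  apply/nbhs_ballP; exists (d / M); first by rewrite /= divr_gt0.
  by move=> z; rewrite -ball_normE /= sub0r normrN ltr_pdivlMr.
have hd' := near_real hd.
near=> h.
have h0 : 0 < h by near: h; exact: nbhs_right_gt.
have hM : `|h%:C| * M < d by near: h; apply: filterS hd' => h ? _.
rewrite norm_real gtr0_norm // in hM.
have leM a b : 0 <= a <= h -> 0 <= b <= h ->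
    `|b%:C *: v + a%:C *: u| <= h%:C * M.
  move=> /andP[a0 ah] /andP[b0 bh]; apply: le_trans (ler_normD _ _) _.
  rewrite !normrZ !norm_real !ger0_norm // /M !mulrDr mulr1.
  apply: ler_wpDr; first by rewrite ler0c ltW.
  by rewrite addrC lerD // ler_wpM2r ?lecR.
have ballP a b : 0 <= a <= h -> 0 <= b <= h -> ball 0 d (b%:C *: v + a%:C *: u).
  move=> a0h b0h; rewrite -ball_normE /= sub0r normrN.
  exact: le_lt_trans (leM _ _ a0h b0h) hM.
have hh : 0 <= h <= h by rewrite lexx ltW.
have oo : 0 <= (0 : R) <= h by rewrite lexx ltW.
have dfx a b : 0 <= a <= h -> 0 <= b <= h ->
    differentiable f (x + b%:C *: v + a%:C *: u).
  by move=> a0h b0h; have [+ _] := dP _ (ballP _ _ a0h b0h); rewrite addrC addrA.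
have dfx0 a : 0 <= a <= h -> differentiable f (x + a%:C *: u).
  by move=> a0h; have := dfx _ _ a0h oo; rewrite rmorph0 scale0r addr0.
have [||c ch ->] := @mean_value f x u h h0 _ (h%:C *: v) _.
- by move=> t; rewrite in_itv /=; exact: dfx0.
- by move=> t; rewrite in_itv /= => ?; exact: dfx.
have ch0 : 0 <= c <= h by move: ch; rewrite in_itv /= => /andP[/ltW-> /ltW].
(* One factor [h] is the length in the mean value theorem and cancels here; the other will come from
   the size of the increments. *)
rewrite expr2 -mulrA -mulrBr normrM mulrA [e * h]mulrC -mulrA gtr0_norm //.
rewrite ler_wpM2l ?(ltW h0) // -lamZ -lamB -lecR.
apply: le_trans (lam_le _) _.
have FE y : differentiable f y -> 'd f y u = F y.
  by move=> ?; rewrite /F deriveE.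
rewrite (FE _ (dfx _ _ ch0 hh)) (FE _ (dfx0 _ ch0)).
have [_ A1] := dP _ (ballP _ _ ch0 hh).
have [_ A2] := dP _ (ballP _ _ ch0 oo).
rewrite rmorph0 scale0r add0r in A2.
rewrite (addrC _ x) addrA in A1; rewrite (addrC _ x) in A2.
have -> : F (x + h%:C *: v + c%:C *: u) - F (x + c%:C *: u) -
    h%:C * 'd F x v =
    (F (x + h%:C *: v + c%:C *: u) - F x - 'd F x (h%:C *: v + c%:C *: u)) -
    (F (x + c%:C *: u) - F x - 'd F x (c%:C *: u)).
  have -> : 'd F x (h%:C *: v + c%:C *: u) =
      h%:C * 'd F x v + 'd F x (c%:C *: u) by rewrite linearD linearZ.
  exact: subr_cancel_common.
apply: le_trans (ler_normB _ _) _; apply: le_trans (lerD A1 A2) _.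
rewrite -mulrDr -mulrA rmorphM /= ler_wpM2l ?ler0c ?(ltW e0) //.
rewrite mulrC ler_pdivrMr ?mulrn_wgt0 // mulrnAr mulr2n lerD ?leM //.
by have := leM _ _ ch0 oo; rewrite rmorph0 scale0r add0r.
Unshelve. all: by end_near. Qed.

Lemma derive_comm_part (f : V -> C) x u v :
  (\forall y \near x, differentiable f y) ->
  differentiable ('D_u f) x -> differentiable ('D_v f) x ->
  lam ('d ('D_u f) x v) = lam ('d ('D_v f) x u).
Proof.
move=> df dFu dFv; apply/eqP; rewrite -subr_eq0 -normr_eq0.
apply/negPn/negP => ne0.
set A := lam _ in ne0; set B := lam ('d ('D_v f) x u) in ne0.
(* With a quarter of the gap, the two errors together leave at most half of it, a contradiction. *)
have e0 : 0 < `|A - B| / 4 by rewrite divr_gt0 // lt_def ne0 normr_ge0.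
set e := `|A - B| / 4 in e0 *.
have [h [[HA HB] h0]] := filter_ex (filterI (filterI
  (second_difference v df dFu e0) (second_difference u df dFv e0))
  (nbhs_right_gt (0 : R))).
rewrite [x + _ + _]addrAC [_ - _ - _]subr_swap -/B in HB; rewrite -/A in HA.
set X := lam _ in HA HB.
have : h ^+ 2 * `|A - B| <= h ^+ 2 * (`|A - B| / 2).
  rewrite -[h ^+ 2 in leLHS]ger0_norm ?exprn_ge0 ?(ltW h0) // -normrM.
  have -> : h ^+ 2 * (A - B) = (X - h ^+ 2 * B) - (X - h ^+ 2 * A) by ring.
  apply: le_trans (ler_normB _ _) _; apply: le_trans (lerD HB HA) _.
  by rewrite /e le_eqVlt; apply/orP; left; apply/eqP; field.
rewrite ler_pM2l ?exprn_gt0 //.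
have := normr_ge0 (A - B); move: ne0; set r := `|A - B| => ne0 r0.
have {ne0 r0} : 0 < r by rewrite lt_def ne0.
by move=> r0 rr; lra.
Qed.

End RealPart.

(* The only property of the complex numbers used below, besides being a
   [numFieldType]. *)
Definition derivatives_commute (K : numFieldType) : Prop :=
  forall (V : normedModType K) (f : V -> K) x u v,
    (\forall y \near x, differentiable f y) ->
    differentiable ('D_u f) x -> differentiable ('D_v f) x ->
    'D_v ('D_u f) x = 'D_u ('D_v f) x.

Section Schwarz.
Local Open Scope complex_scope.
Variable R : realType.
Local Notation C := (R[i] : numFieldType).

Lemma complex_derivatives_commute : derivatives_commute C.
Proof.
move=> V f x u v df dFu dFv.
apply: (etrans (deriveE v dFu)); apply: (etrans _ (esym (deriveE u dFv))).
apply/eqP; rewrite eq_complex; apply/andP; split; apply/eqP.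
- have ReB (a b : C) : complex.Re (a - b) = complex.Re a - complex.Re b.
    by case: a b => [? ?] [? ?].
  have ReZ (h : R) (a : C) : complex.Re (h%:C * a) = h * complex.Re a.
    by case: a => a b /=; rewrite mul0r subr0.
  exact (derive_comm_part ReB ReZ (@normc_ge_Re R) df dFu dFv).
- have ImB (a b : C) : complex.Im (a - b) = complex.Im a - complex.Im b.
    by case: a b => [? ?] [? ?].
  have ImZ (h : R) (a : C) : complex.Im (h%:C * a) = h * complex.Im a.
    by case: a => a b /=; rewrite mul0r addr0.
  have Im_le (a : C) : `|complex.Im a|%:C <= `|a|.
    (* Multiplication by i preserves the norm and turns the imaginary part into minus the real
       part. *)
    have := normc_ge_Re (a * 'i%C); rewrite ReiNIm normrN normrM.
    have -> : `|'i%C : C| = 1 by rewrite normc_def /= expr0n expr1n add0r sqrtr1.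
    by rewrite mulr1.
  exact (derive_comm_part ImB ImZ Im_le df dFu dFv).
Qed.

End Schwarz.

Lemma partial_comm (K : numFieldType) n (f : 'rV[K]_n -> K) x i j :
  derivatives_commute K -> (\forall y \near x, differentiable f y) ->
  differentiable (partial i f) x -> differentiable (partial j f) x ->
  partial j (partial i f) x = partial i (partial j f) x.
Proof. by move=> dK df dfi dfj; exact: dK. Qed.

(** * Polynomial and rational functions *)

Section PartialRules.
Variables (K : numFieldType) (n : nat).
Implicit Types (f g : 'rV[K]_n -> K) (x : 'rV[K]_n) (i : 'I_n).

Lemma near_eq_partial f g i x :
  {near x, f =1 g} -> partial i f x = partial i g x.
Proof. exact: near_eq_derive. Qed.

Lemma open_near_eq (D : set 'rV[K]_n) f g x :
  open D -> D x -> (forall y, D y -> f y = g y) -> {near x, f =1 g}.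
Proof. by move=> oD Dx fg; apply: filterS (open_nbhs_nbhs (conj oD Dx)). Qed.

Lemma partial_cst c i x : partial i (fun=> c : K) x = 0.
Proof. exact: derive_cst. Qed.

Lemma partialD f g i x : differentiable f x -> differentiable g x ->
  partial i (fun y => f y + g y) x = partial i f x + partial i g x.
Proof. by move=> df dg; apply: deriveD; exact: diff_derivable. Qed.

Lemma partialM f g i x : differentiable f x -> differentiable g x ->
  partial i (fun y => f y * g y) x = f x * partial i g x + g x * partial i f x.
Proof. by move=> df dg; apply: deriveM; exact: diff_derivable. Qed.

Lemma partial_coord j i x : partial i (fun y : 'rV[K]_n => y 0 j) x = (i == j)%:R.
Proof.
have dc : differentiable (fun y : 'rV[K]_n => y 0 j) x.
  exact: differentiable_coord.
rewrite /partial (deriveE _ dc) (@diff_coord _ _ _ (@id 'rV[K]_n)) //.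
by rewrite diff_val mxE eqxx eq_sym.
Qed.

Lemma mpoly_ring_ind (A : comNzRingType) k (P : mpoly k A -> Prop) :
  (forall c, P (@mpolyC k A c)) -> (forall i : 'I_k, P (mpolyX A (mnm1 i))) ->
  (forall p q, P p -> P q -> P (p + q)) ->
  (forall p q, P p -> P q -> P (p * q)) -> forall p, P p.
Proof.
move=> PC PX PD PM p; rewrite (mpolyE p).
apply: (big_ind P) => [||u _]; [by rewrite -(mpolyC0 k)|exact: PD|].
rewrite -mul_mpolyC mpolyXE_id; apply: (PM) => //.
apply: (big_ind P) => [||i _]; [exact: PC|exact: PM|].
elim: (u i) => [|m IHm]; first by rewrite expr0; exact: PC.
by rewrite exprS; apply: (PM).
Qed.

Lemma meval_diff (p : mpoly n K) x :
  differentiable (fun y : 'rV[K]_n => meval (y 0) p) x /\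
  forall i, partial i (fun y : 'rV[K]_n => meval (y 0) p) x = meval (x 0) (mderiv i p).
Proof.
elim/mpoly_ring_ind: p => [c|j|p q [dp Ep] [dq Eq]|p q [dp Ep] [dq Eq]].
- rewrite (_ : (fun y => _) = fun=> c); last by apply/funext => y; rewrite mevalC.
  split; first exact: differentiable_cst.
  by move=> i; rewrite partial_cst mderivC meval0.
- rewrite (_ : (fun y => _) = fun y : 'rV[K]_n => y 0 j); last first.
    by apply/funext => y; rewrite mevalXU.
  split; first exact: differentiable_coord.
  move=> i; rewrite partial_coord mderivX mnm1E eq_sym mevalZ.
  case: eqP => [->|_]; last by rewrite mul0r.
  rewrite (_ : mnm_sub _ _ = mnm0) ?mpolyX0 ?meval1 ?mulr1 //.
  by apply/mnmP => l; rewrite mnmBE subnn mnm0E.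
- rewrite (_ : (fun y => _) = fun y : 'rV[K]_n => meval (y 0) p + meval (y 0) q); last first.
    by apply/funext => y; rewrite mevalD.
  split; first exact: differentiableD.
  by move=> i; rewrite partialD // Ep Eq mderivD mevalD.
- rewrite (_ : (fun y => _) = fun y : 'rV[K]_n => meval (y 0) p * meval (y 0) q); last first.
    by apply/funext => y; rewrite mevalM.
  split; first exact: differentiableM.
  move=> i; rewrite partialM // Ep Eq mderivM mevalD !mevalM.
  by rewrite addrC [X in X + _]mulrC.
Qed.

Lemma differentiable_meval (p : mpoly n K) x :
  differentiable (fun y : 'rV[K]_n => meval (y 0) p) x.
Proof. by have [] := meval_diff p x. Qed.

Lemma partial_meval (p : mpoly n K) i x :
  partial i (fun y : 'rV[K]_n => meval (y 0) p) x = meval (x 0) (mderiv i p).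
Proof. by have [_] := meval_diff p x. Qed.

Lemma open_meval_neq0 (p : mpoly n K) :
  open [set x : 'rV[K]_n | meval (x 0) p != 0].
Proof.
rewrite openE => x px.
have cp := differentiable_continuous (differentiable_meval p x).
exact: cvgr_neq0 cp px.
Qed.

(** The partial derivatives of [p] also vanish on [D] and have smaller degree, so they are zero by
    induction. In characteristic zero [p] is then a constant, which is read off at one point. *)
Lemma mpoly_vanishing_open (D : set 'rV[K]_n) (p : mpoly n K) :
  open D -> D !=set0 -> (forall x, D x -> meval (x 0) p = 0) -> p = 0.
Proof.
move=> oD [x0 Dx0]; have [k] := ubnP (msize p).
elim: k p => // k IHk p; rewrite ltnS => pk p0.
have [//|pn0] := eqVneq p 0.
have dp0 i : mderiv i p = 0.
  apply: IHk => [|x Dx]; last first.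
    rewrite -partial_meval -(partial_cst 0 i x); apply: near_eq_partial.
    exact: open_near_eq Dx _.
  case: k pk => [|k] pk.
    by move: pk; rewrite leqn0 msize_poly_eq0 (negbTE pn0).
  rewrite ltnS msizeE; apply/bigmax_leqP_seq => u + _.
  rewrite mcoeff_msupp mcoeff_deriv; apply: contraR; rewrite -leqNgt => ku.
  rewrite memN_msupp_eq0 ?mul0rn //; apply: msize_mdeg_ge.
  by rewrite mdegD mdeg1 addn1 (leq_trans pk).
have pC : p = @mpolyC n K (mcoeff mnm0 p).
  apply/mpolyP => u; rewrite mcoeffC eq_sym; have [->|u0] := eqVneq u mnm0.
    by rewrite mulr1.
  rewrite mulr0; have [i ui] : exists i, u i != 0%N.
    apply/existsP; apply: contraR u0; rewrite negb_exists => /forallP u0.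
    by apply/eqP/mnmP => i; rewrite mnm0E; apply/eqP/negPn.
  have := mcoeff_deriv i (mnm_sub u (mnm1 i)) p.
  rewrite dp0 mcoeff0 submK; last first.
    by apply/mnm_lepP => j; rewrite mnm1E; case: eqP => // <-; rewrite lt0n.
  by move=> /esym /eqP; rewrite mulrn_eq0 => /eqP.
by have := p0 _ Dx0; rewrite pC mevalC => ->; rewrite mpolyC0.
Qed.

End PartialRules.

Section RationalOn.
Variables (K : numFieldType) (n : nat).
Local Notation rat := (@rat_of_mpoly K n).
Implicit Types (f g : 'rV[K]_n -> K) (D : set 'rV[K]_n).

(** One element of the fraction field serves all of [D], but the denominator that gives its value
    may vary with the point. *)
Definition rational_on D f : Prop :=
  exists c : ratfun K n, forall x, D x -> has_value rat c x (f x).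

Lemma rational_on_sub D D' f : D' `<=` D -> rational_on D f -> rational_on D' f.
Proof. by move=> sD [c cf]; exists c => x /sD; apply: cf. Qed.

Lemma eq_rational_on D f g : (forall x, D x -> f x = g x) ->
  rational_on D f -> rational_on D g.
Proof. by move=> fg [c cf]; exists c => x Dx; rewrite -fg //; apply: cf. Qed.

Lemma rational_on_meval D p : rational_on D (fun x => meval (x 0) p).
Proof.
exists (rat p) => x _; rewrite has_valueE.
exact: (transfer_image rat (meval (x 0))).
Qed.

Lemma rational_on_cst D c : rational_on D (fun=> c).
Proof.
apply: eq_rational_on (rational_on_meval D (@mpolyC n K c)) => x _.
by rewrite mevalC.
Qed.

Lemma rational_onD D f g :
  rational_on D f -> rational_on D g -> rational_on D (fun x => f x + g x).
Proof.
move=> [c cf] [e eg]; exists (c + e) => x Dx.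
by apply: transferD; [apply: cf|apply: eg].
Qed.

Lemma rational_onM D f g :
  rational_on D f -> rational_on D g -> rational_on D (fun x => f x * g x).
Proof.
move=> [c cf] [e eg]; exists (c * e) => x Dx.
by apply: transferM; [apply: cf|apply: eg].
Qed.

Lemma rational_onV D f : (forall x, D x -> f x != 0) ->
  rational_on D f -> rational_on D (fun x => (f x)^-1).
Proof.
move=> f0 [c cf]; exists c^-1 => x Dx.
by apply: transferV (f0 _ Dx); [exact: rat_specializes|apply: cf].
Qed.

Lemma rational_on_sum (I : Type) (r : seq I) (P : pred I) D
    (f : I -> 'rV[K]_n -> K) :
  (forall k, P k -> rational_on D (f k)) ->
  rational_on D (fun x => \sum_(k <- r | P k) f k x).
Proof.
move=> Df; elim: r => [|k r IHr].
  by apply: eq_rational_on (rational_on_cst D 0) => x _; rewrite big_nil.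
have [Pk|nPk] := boolP (P k).
  apply: eq_rational_on (rational_onD (Df _ Pk) IHr) => x _.
  by rewrite big_cons Pk.
by apply: eq_rational_on IHr => x _; rewrite big_cons (negbTE nPk).
Qed.

Lemma rational_on_prod (I : Type) (r : seq I) (P : pred I) D
    (f : I -> 'rV[K]_n -> K) :
  (forall k, P k -> rational_on D (f k)) ->
  rational_on D (fun x => \prod_(k <- r | P k) f k x).
Proof.
move=> Df; elim: r => [|k r IHr].
  by apply: eq_rational_on (rational_on_cst D 1) => x _; rewrite big_nil.
have [Pk|nPk] := boolP (P k).
  apply: eq_rational_on (rational_onM (Df _ Pk) IHr) => x _.
  by rewrite big_cons Pk.
by apply: eq_rational_on IHr => x _; rewrite big_cons (negbTE nPk).
Qed.

Lemma rational_on_det k D (M : 'rV[K]_n -> 'M[K]_k) :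
  (forall i j, rational_on D (fun x => M x i j)) ->
  rational_on D (fun x => \det (M x)).
Proof.
move=> DM; apply: rational_on_sum => s _; apply: rational_onM.
  exact: rational_on_cst.
by apply: rational_on_prod => i _; apply: DM.
Qed.

Lemma rational_on_invmx k D (M : 'rV[K]_n -> 'M[K]_k) :
  (forall x, D x -> M x \in unitmx) ->
  (forall i j, rational_on D (fun x => M x i j)) ->
  forall i j, rational_on D (fun x => invmx (M x) i j).
Proof.
move=> uM DM i j.
apply: (@eq_rational_on D (fun x => (\det (M x))^-1 * cofactor (M x) j i)).
  by move=> x Dx; rewrite /invmx uM // !mxE.
apply: rational_onM.
  apply: rational_onV; last exact: rational_on_det.
  by move=> x Dx; have := uM _ Dx; rewrite unitmxE unitfE.
apply: rational_onM; first exact: rational_on_cst.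
apply: rational_on_det => i' j'.
apply: eq_rational_on (DM (lift j i') (lift i j')) => x _.
by rewrite !mxE.
Qed.

Lemma has_value_frac p q (x : 'rV[K]_n) : meval (x 0) q != 0 ->
  has_value rat (rat p / rat q) x (meval (x 0) p / meval (x 0) q).
Proof.
move=> qx; exists p, q; split=> //.
by apply: contra qx => /eqP /rat_specializes ->.
Qed.

Lemma eq_rat_div (a b q q' : mpoly n K) : rat q != 0 -> rat q' != 0 ->
  a * q' = b * q -> rat a / rat q = rat b / rat q'.
Proof.
move=> q0 q0' E; apply/eqP.
by rewrite (eqr_div _ _ q0 q0') -!rmorphM E eqxx.
Qed.

(** The denominator chosen at [x] stays nonzero nearby, and uniqueness of values makes this one
    fraction equal to [f] on a neighbourhood, where it can be differentiated. *)
Lemma has_value_locally D f c x : open D ->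
  (forall x, D x -> has_value rat c x (f x)) -> D x ->
  exists p q, [/\ meval (x 0) q != 0, rat q != 0, c = rat p / rat q &
    {near x, (fun y : 'rV[K]_n => meval (y 0) p / meval (y 0) q) =1 f}].
Proof.
move=> oD cf Dx; have [p [q [q0 cE qx _]]] := cf x Dx; exists p, q; split=> //.
have Dq : open (D `&` [set y : 'rV[K]_n | meval (y 0) q != 0]).
  by apply: openI => //; exact: open_meval_neq0.
apply: (open_near_eq Dq) => // y [Dy qy].
apply: has_value_uniq (cf y Dy); first exact: rat_specializes.
by rewrite cE; exact: has_value_frac.
Qed.

Lemma differentiable_quotient p q (x : 'rV[K]_n) : meval (x 0) q != 0 ->
  differentiable (fun y : 'rV[K]_n => meval (y 0) p / meval (y 0) q) x.
Proof.
move=> qx; apply: differentiableM; first exact: differentiable_meval.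
by apply: differentiableV => //; exact: differentiable_meval.
Qed.

Lemma rational_on_diff D f x :
  open D -> rational_on D f -> D x -> differentiable f x.
Proof.
move=> oD [c cf] Dx; have [p [q [qx _ _ pqf]]] := has_value_locally oD cf Dx.
by apply: near_eq_differentiable pqf _; exact: differentiable_quotient.
Qed.

Lemma rational_on_partial D f i :
  open D -> rational_on D f -> rational_on D (partial i f).
Proof.
move=> oD [c cf].
(* The derivative has to be a single rational function, hence is built from a global fraction P/Q.
   Since [Q] may vanish at [x], its value there is computed from a local fraction p/q. *)
have [P [Q [Q0 cE _ _]]] := rat_is_fraction c.
exists (rat (mderiv i P * Q - P * mderiv i Q) / rat (Q ^+ 2)) => x Dx.
have [p [q [qx q0 cE' pqf]]] := has_value_locally oD cf Dx.
have E : p * Q = P * q.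
  have /eqP : rat p / rat q = rat P / rat Q by exact: etrans (esym cE') cE.
  rewrite (eqr_div _ _ q0 Q0) -!rmorphM => /eqP E; apply/eqP.
  by rewrite -subr_eq0 -rat_of_mpoly_eq0 rmorphB /= E subrr.
have -> : rat (mderiv i P * Q - P * mderiv i Q) / rat (Q ^+ 2) =
          rat (mderiv i p * q - p * mderiv i q) / rat (q ^+ 2).
  have sqr0 r : rat r != 0 -> rat (r ^+ 2) != 0.
    by move=> r0; rewrite rmorphXn expf_neq0.
  apply: (eq_rat_div (sqr0 _ Q0) (sqr0 _ q0)); apply/subr0_eq.
  have E' : mderiv i p * Q + p * mderiv i Q = mderiv i P * q + P * mderiv i q.
    by rewrite -!mderivM E.
  (* The two quotient rules agree by a combination of the relation [E] and its derivative [E']. *)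
  rewrite (_ : _ - _ = (P * q - p * Q) * (- q * mderiv i Q - Q * mderiv i q) +
    Q * q * (mderiv i P * q + P * mderiv i q -
             (mderiv i p * Q + p * mderiv i Q))); last by ring.
  by rewrite E E' !subrr mul0r mulr0 addr0.
have -> : partial i f x = meval (x 0) (mderiv i p * q - p * mderiv i q) /
    meval (x 0) (q ^+ 2).
  rewrite -(near_eq_partial i pqf).
  (* The quotient rule is recovered by differentiating the product of p/q and [q], and solving for
     the derivative of p/q. *)
  have pq : {near x, (fun y : 'rV[K]_n =>
      meval (y 0) p / meval (y 0) q * meval (y 0) q) =1
      (fun y : 'rV[K]_n => meval (y 0) p)}.
    apply: (open_near_eq (@open_meval_neq0 K n q)) => // y qy.
    by rewrite divfK.
  have := near_eq_partial i pq; rewrite partialM ?partial_meval //; last first.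
  - exact: differentiable_meval.
  - exact: differentiable_quotient.
  set dq := partial _ _ _; rewrite mevalB !mevalM => <-.
  by field.
apply: has_value_frac; rewrite rmorphXn /= expf_neq0 //.
Qed.

Lemma open_regular (c : ratfun K n) : open [set x | regular rat c x].
Proof.
rewrite openE => x [v [p [q [q0 cE qx _]]]].
apply: filterS (open_nbhs_nbhs (conj (@open_meval_neq0 K n q) qx)) => y qy.
by exists (meval (y 0) p / meval (y 0) q), p, q.
Qed.

Lemma rational_on_value (c : ratfun K n) :
  rational_on [set x | regular rat c x] (value rat c).
Proof. by exists c => x /regular_value. Qed.

End RationalOn.

(** * Holomorphic functions *)

Section Smooth.
Variable K : numFieldType.

(* Closure under products and composition is proved by induction on the order
   of differentiation, which [holomorphic_on] hides. *)
Fixpoint smooth (n k : nat) (D : set 'rV[K]_n) (f : 'rV[K]_n -> K) : Prop :=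
  (forall x, D x -> differentiable f x) /\
  if k is k'.+1 then forall i, smooth k' D (partial i f) else True.

Lemma smooth_diff n k (D : set 'rV[K]_n) f x :
  smooth k D f -> D x -> differentiable f x.
Proof. by case: k => [|k] [df _]; apply: df. Qed.

Lemma smoothS n k (D : set 'rV[K]_n) f : smooth k.+1 D f -> smooth k D f.
Proof.
elim: k f => [|k IHk] f [df Df]; split=> // i; apply: IHk; exact: Df.
Qed.

(** The last letter of a word is the derivative taken first, so the recursion of [smooth] peels
    words from the right. *)
Lemma holomorphic_smooth n (D : set 'rV[K]_n) f :
  holomorphic_on D f <-> forall k, smooth k D f.
Proof.
split=> [hf k|sf s x Dx].
  elim: k f hf => [|k IHk] f hf; (split; first exact: (hf [::])) => // i.
  by apply: IHk => s x Dx; have := hf (rcons s i) x Dx; rewrite foldr_rcons.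
elim/last_ind: s f sf => [|s i IHs] f sf; first exact: smooth_diff (sf 0%N) Dx.
by rewrite foldr_rcons; apply: IHs => k; have [_ sf'] := sf k.+1; exact: sf'.
Qed.

Lemma holomorphic_partial n (D : set 'rV[K]_n) f i :
  holomorphic_on D f -> holomorphic_on D (partial i f).
Proof.
by move=> hf s x Dx; have := hf (rcons s i) x Dx; rewrite foldr_rcons.
Qed.

Lemma holomorphic_diff n (D : set 'rV[K]_n) f x :
  holomorphic_on D f -> D x -> differentiable f x.
Proof. by move=> hf Dx; exact: (hf [::] x Dx). Qed.

Lemma eq_smooth n k (D : set 'rV[K]_n) f g : open D ->
  (forall x, D x -> f x = g x) -> smooth k D f -> smooth k D g.
Proof.
move=> oD; elim: k f g => [|k IHk] f g fg sf.
  split=> // x Dx.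
  exact: near_eq_differentiable (open_near_eq oD Dx fg) (smooth_diff sf Dx).
split=> [x Dx|i].
  exact: near_eq_differentiable (open_near_eq oD Dx fg) (smooth_diff sf Dx).
case: sf => _ sf; apply: IHk (sf i) => x Dx; apply: near_eq_partial.
exact: open_near_eq oD Dx fg.
Qed.

Lemma smooth_cst n k (D : set 'rV[K]_n) c : smooth k D (fun=> c).
Proof.
elim: k c => [|k IHk] c; (split; first by move=> x _; exact: differentiable_cst).
  by [].
move=> i; rewrite (_ : partial i _ = fun=> 0); first exact: IHk.
by apply/funext => x; exact: partial_cst.
Qed.

Lemma smoothD n k (D : set 'rV[K]_n) f g : open D ->
  smooth k D f -> smooth k D g -> smooth k D (fun x => f x + g x).
Proof.
move=> oD; elim: k f g => [|k IHk] f g sf sg.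
  split=> // x Dx; apply: differentiableD.
    exact: smooth_diff sf Dx.
  exact: smooth_diff sg Dx.
split=> [x Dx|i].
  apply: differentiableD; [exact: smooth_diff sf Dx|].
  exact: smooth_diff sg Dx.
apply: (@eq_smooth _ _ _ (fun x => partial i f x + partial i g x)) => //.
    move=> x Dx; rewrite partialD //; [exact: smooth_diff sf Dx|].
    exact: smooth_diff sg Dx.
  case: sf sg => _ sf [_ sg]; apply: IHk; [exact: sf|exact: sg].
Qed.

Lemma smoothM n k (D : set 'rV[K]_n) f g : open D ->
  smooth k D f -> smooth k D g -> smooth k D (fun x => f x * g x).
Proof.
move=> oD; elim: k f g => [|k IHk] f g sf sg.
  split=> // x Dx; apply: differentiableM.
    exact: smooth_diff sf Dx.
  exact: smooth_diff sg Dx.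
split=> [x Dx|i].
  apply: differentiableM; [exact: smooth_diff sf Dx|].
  exact: smooth_diff sg Dx.
apply: (@eq_smooth _ _ _
    (fun x => f x * partial i g x + g x * partial i f x)) => //.
    move=> x Dx; rewrite partialM //; [exact: smooth_diff sf Dx|].
    exact: smooth_diff sg Dx.
  have [_ sf'] := sf; have [_ sg'] := sg.
  apply: smoothD => //; apply: IHk; try exact: smoothS.
    exact: sg'.
  exact: sf'.
Qed.

Lemma smooth_sum n k (D : set 'rV[K]_n) (I : Type) (r : seq I) (P : pred I)
    (f : I -> 'rV[K]_n -> K) : open D ->
  (forall l, P l -> smooth k D (f l)) ->
  smooth k D (fun x => \sum_(l <- r | P l) f l x).
Proof.
move=> oD sf; elim: r => [|l r IHr].
  by apply: eq_smooth (smooth_cst k D 0) => // x _; rewrite big_nil.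
have [Pl|nPl] := boolP (P l).
  by apply: eq_smooth (smoothD oD (sf l Pl) IHr) => // x _; rewrite big_cons Pl.
by apply: eq_smooth IHr => // x _; rewrite big_cons (negbTE nPl).
Qed.

(** By the chain rule a partial derivative of the composite is a sum of products whose factors are
    smooth to one order less, by induction or by hypothesis. *)
Lemma smooth_comp n N k (D : set 'rV[K]_n) (E : set 'rV[K]_N) f
    (g : 'rV[K]_n -> 'rV[K]_N) : open D -> (forall x, D x -> E (g x)) ->
  smooth k E f -> (forall j, smooth k D (fun x => g x 0 j)) ->
  smooth k D (f \o g).
Proof.
move=> oD DE; elim: k f => [|k IHk] f sf sg.
  split=> // x Dx; apply: differentiable_comp.
    by apply: differentiable_rV => j; exact: smooth_diff (sg j) Dx.
  exact: smooth_diff sf (DE _ Dx).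
have dg x : D x -> differentiable g x.
  by move=> Dx; apply: differentiable_rV => j; exact: smooth_diff (sg j) Dx.
split=> [x Dx|i].
  apply: differentiable_comp; first exact: dg.
  exact: smooth_diff sf (DE _ Dx).
apply: (@eq_smooth _ _ _ (fun x =>
    \sum_j (partial j f \o g) x * partial i (fun y => g y 0 j) x)) => //.
  move=> x Dx; rewrite partial_comp //; first exact: dg.
  exact: smooth_diff sf (DE _ Dx).
apply: smooth_sum => // j _; apply: smoothM => //.
  case: sf => _ sf; apply: IHk => [|l]; [exact: sf|exact: smoothS].
by have [_ sgj] := sg j; exact: sgj.
Qed.

Lemma rational_on_holomorphic n (D : set 'rV[K]_n) f :
  open D -> rational_on D f -> holomorphic_on D f.
Proof.
move=> oD rf; apply/holomorphic_smooth => k.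
elim: k f rf => [|k IHk] f rf.
  by split=> // x Dx; exact: rational_on_diff rf Dx.
split=> [x Dx|i]; first exact: rational_on_diff rf Dx.
by apply: IHk; exact: rational_on_partial.
Qed.

Lemma holomorphic_comp n N (D : set 'rV[K]_n) (E : set 'rV[K]_N) f
    (g : 'rV[K]_n -> 'rV[K]_N) : open D -> (forall x, D x -> E (g x)) ->
  holomorphic_on E f -> (forall j, holomorphic_on D (fun x => g x 0 j)) ->
  holomorphic_on D (f \o g).
Proof.
move=> oD DE /holomorphic_smooth sf sg; apply/holomorphic_smooth => k.
apply: smooth_comp DE (sf k) _ => // j.
by move/holomorphic_smooth: (sg j).
Qed.

End Smooth.

(** * The parametrization of the radical variety *)

Lemma rat_vanishing_ideal (K : numFieldType) n (W : set 'rV[K]_n) :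
  open W -> W !=set0 -> vanishing_ideal (@rat_of_mpoly K n) W.
Proof.
move=> oW W0 p; split=> [rp w _|pW]; first exact: rat_specializes rp.
by rewrite (mpoly_vanishing_open oW W0 pW) rmorph0.
Qed.

Section ParamEval.
Variables (K : numFieldType) (k N : nat) (Q : 'I_N -> ratfun K k).
Local Notation rat := (@rat_of_mpoly K k).

Definition param_eval (P : mpoly N K) : ratfun K k :=
  mmap (fun x => rat (@mpolyC k K x)) Q P.

Let param_scalar : {rmorphism K -> ratfun K k} :=
  @rat_of_mpoly K k \o @mpolyC k K.

Lemma param_eval_is_zmod_morphism : zmod_morphism param_eval.
Proof. exact: (@mmap_is_additive _ _ _ _ param_scalar). Qed.

Lemma param_eval_is_monoid_morphism : monoid_morphism param_eval.
Proof.
by have [mulQ oneQ] := @mmap_is_multiplicative _ _ (ratfun K k) Q param_scalar.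
Qed.

HB.instance Definition _ := GRing.isZmodMorphism.Build _ _ param_eval
  param_eval_is_zmod_morphism.
HB.instance Definition _ := GRing.isMonoidMorphism.Build _ _ param_eval
  param_eval_is_monoid_morphism.

Lemma param_evalC x : param_eval (@mpolyC N K x) = rat (@mpolyC k K x).
Proof. exact: (@mmapC _ _ _ _ param_scalar). Qed.

Lemma param_evalX l : param_eval (mpolyX K (mnm1 l)) = Q l.
Proof.
by rewrite /param_eval (@mmapX _ _ _ _ param_scalar) mmap1U.
Qed.

Lemma has_value_param_eval z P : ratmap_regular Q z ->
  has_value rat (param_eval P) z (meval (ratmap_value Q z 0) P).
Proof.
move=> regz; apply: has_value_mmap => l.
by rewrite mxE; exact: regular_value.
Qed.

Lemma param_eval_eq0 P : param_eval P = 0 <->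
  forall w, [set ratmap_value Q z | z in ratmap_regular Q] w ->
    meval (w 0) P = 0.
Proof.
have ratT : vanishing_ideal rat setT.
  by apply: rat_vanishing_ideal; [exact: openT|exists 0].
rewrite /param_eval (vanishing_ideal_values P ratT); last first.
  by move=> l; exact: rat_is_fraction.
have E z : meval (ratmap_value Q z 0) P = meval (fun l => value rat (Q l) z) P.
  by apply: meval_eq => l; rewrite mxE.
split=> [QP _ [z regz <-]|QP z _ regz]; first by rewrite E; exact: QP.
by rewrite -E; apply: QP; exists z.
Qed.

Lemma specializes_param_eval z : ratmap_regular Q z ->
  specializes param_eval (ratmap_value Q z).
Proof. by move=> regz P /param_eval_eq0; apply; exists z. Qed.

(** Evaluation at Q(z) is substitution of [Q] followed by evaluation at [z], so a value of [a] at
    Q(z) is one of its image [c] at [z]. *)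
Lemma has_value_param (L : fieldType) (i : {rmorphism mpoly N K -> L}) a c v z :
  (forall p, i p = 0 -> param_eval p = 0) -> ratmap_regular Q z ->
  transfer i param_eval a c -> has_value i a (ratmap_value Q z) v ->
  has_value rat c z v.
Proof.
move=> iQ regz ac av; have spz := specializes_param_eval regz.
have [p [q [q0 -> qz ->]]] := transfer_comp iQ ac av spz.
apply: transferM; first exact: has_value_param_eval.
apply: transferV => //; first exact: rat_specializes.
exact: has_value_param_eval.
Qed.

Lemma param_eval_ker (L : fieldType) (i : {rmorphism mpoly N K -> L}) S P :
  vanishing_ideal i S -> rational_parametrization (zariski_closure S) Q ->
  (i P == 0) = (param_eval P == 0).
Proof.
move=> iS /eq_zariski_closure E.
by apply/eqP/eqP => [/iS/E|] H; [apply/param_eval_eq0|apply/iS/E/param_eval_eq0].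
Qed.

End ParamEval.

Section Tower.
Variables (K : numFieldType) (n m : nat) (T : radical_tower K n m).
Variables (U : set 'rV[K]_n) (d : 'rV[K]_n -> 'rV[K]_m).
Hypothesis branchUd : is_branch T U d.

Lemma tower_vanishing_ideal W : W `<=` U -> open W -> W !=set0 ->
  vanishing_ideal (tower_poly T) [set tower_point d x | x in W].
Proof.
move=> WU oW W0 P; split=> [P0 _ [x Wx <-]|PW].
  exact: (branch_relations branchUd P0 (WU _ Wx)).
apply/eqP/negPn/negP => /tower_poly_multiple[P' [c [c0 E]]].
move: c0; rewrite (mpoly_vanishing_open oW W0 (p := c)) ?eqxx // => x Wx.
have /eqP := branch_relations branchUd E (WU _ Wx).
rewrite mevalB mevalM PW; last by exists x.
by rewrite mul0r sub0r oppr_eq0 meval_lift_base row_mxKl => /eqP.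
Qed.

Lemma tower_vanishing_idealU :
  vanishing_ideal (tower_poly T) [set tower_point d x | x in U].
Proof.
by apply: tower_vanishing_ideal;
  [|exact: branch_open branchUd|exact: branch_nonempty branchUd].
Qed.

Lemma radical_variety_unirational s (F : diffpoly T n s) :
  unirational n (tower_variety U d) -> unirational n (radical_variety U d F).
Proof.
move=> [Q QV]; have ker P := param_eval_ker P tower_vanishing_idealU QV.
have kerQT P : param_eval Q P = 0 -> tower_poly T P = 0.
  by move/eqP; rewrite -ker => /eqP.
have kerTQ P : tower_poly T P = 0 -> param_eval Q P = 0.
  by move/eqP; rewrite ker => /eqP.
set a := nonrational_coeffs F.
have /choice[c ac] (j : 'I_(size a)) :
    exists c, transfer (tower_poly T) (param_eval Q) a`_j c.
  by apply: is_fraction_transfer kerQT _; exact: tower_is_fraction.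
(* [b] lists the coordinates of the radical variety as elements of F_m, and [Q'] their images in
   C(z): both satisfy the same polynomial relations. *)
pose b (l : 'I_(n + size a)) : T := match fintype.split l with
  | inl i => tower_poly T (mpolyX K (mnm1 (lshift m i)))
  | inr j => a`_j end.
pose Q' (l : 'I_(n + size a)) : ratfun K n := match fintype.split l with
  | inl i => Q (lshift m i)
  | inr j => c j end.
have bQ' l : transfer (tower_poly T) (param_eval Q) (b l) (Q' l).
  rewrite /b /Q'; case: (fintype.split l) => // i.
  by rewrite -param_evalX; exact: transfer_image.
exists Q'; apply/eq_zariski_closure => P.
rewrite -param_eval_eq0.
have bP := transfer_mmap (@mpolyC (n + m) K) P bQ'.
have -> : param_eval Q' P =
    mmap (fun x => param_eval Q (@mpolyC (n + m) K x)) Q' P.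
  by apply: eq_bigr => u _; rewrite param_evalC.
have -> : mmap (fun x => param_eval Q (@mpolyC (n + m) K x)) Q' P = 0 <->
    mmap (fun x => tower_poly T (@mpolyC (n + m) K x)) b P = 0.
  split=> E; rewrite E in bP; last exact (transfer_eq0 kerTQ bP).
  exact (transfer_eq0 kerQT (transfer_sym bP)).
rewrite (vanishing_ideal_values P tower_vanishing_idealU); last first.
  rewrite /b => l; case: (fintype.split l) => j; exact: tower_is_fraction.
have vE x l : U x ->
    (forall j : 'I_(size a), regular (tower_poly T) a`_j (tower_point d x)) ->
    value (tower_poly T) (b l) (tower_point d x) =
    row_mx x (\row_j value (tower_poly T) a`_j (tower_point d x)) 0 l.
  move=> Ux regx; rewrite [RHS]mxE /b; case: (fintype.split l) => j.
    apply: value_eq.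
      by apply: vanishing_ideal_specializes tower_vanishing_idealU _; exists x.
    rewrite has_valueE -[x 0 j]/(_) (_ : x 0 j =
      meval (tower_point d x 0) (mpolyX K (mnm1 (lshift m j)))).
      exact: transfer_image.
    by rewrite mevalXU row_mxEl.
  by rewrite mxE.
(* The radical variety asks only the non-rational coefficients to be regular, the criterion all of
   [b]; the coordinates x are regular everywhere. *)
split=> H.
- move=> _ [x [Ux regx] <-].
  rewrite -(H (tower_point d x)); first last.
  + move=> l; rewrite /b; case: (fintype.split l) => // j.
    by exists (meval (tower_point d x 0) (mpolyX K (mnm1 (lshift m j))));
      exact: transfer_image.
  + by exists x.
  by apply: meval_eq => l; rewrite vE.
- move=> _ [x Ux <-] regb.
  have regx (j : 'I_(size a)) : regular (tower_poly T) a`_j (tower_point d x).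
    have := regb (rshift n j).
    by rewrite /b (_ : fintype.split _ = inr j) //; exact: (unsplitK (inr j)).
  rewrite -[RHS](H (row_mx x (\row_j value (tower_poly T) a`_j (tower_point d x)))).
    by apply: meval_eq => l; rewrite vE.
  by exists x.
Qed.

End Tower.

(** * Rationality of the coefficients of (B) *)

Lemma multi_iter_ind (A : Type) n (op : 'I_n -> A -> A) (P : A -> Prop) al t :
  P t -> (forall i t, P t -> P (op i t)) -> P (multi_iter op al t).
Proof.
move=> Pt Pop; rewrite /multi_iter; elim: (enum 'I_n) => //= i s IHs.
by elim: (al i) => //= k IHk; exact: Pop.
Qed.

Section CoefficientsRational.
Variables (K : numFieldType) (n k : nat).
Implicit Types (D : set 'rV[K]_n) (p q : 'rV[K]_n -> mpoly k K).

Definition coeffs_rational_on D p : Prop :=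
  forall u, rational_on D (fun z => mcoeff u (p z)).

Lemma coeffs_rational_on_cst D (p : mpoly k K) :
  coeffs_rational_on D (fun=> p).
Proof. by move=> u; exact: rational_on_cst. Qed.

Lemma coeffs_rational_onM D p q :
  coeffs_rational_on D p -> coeffs_rational_on D q ->
  coeffs_rational_on D (fun z => p z * q z).
Proof.
(* The index set depends on [u] alone, so the coefficient is one finite sum for all [z]. *)
move=> pD qD u; pose b := bmultinom k (mdeg u).+1.
pose f z := \sum_(v : b * b | u == mnm_add (bmnm v.1) (bmnm v.2))
  mcoeff (bmnm v.1) (p z) * mcoeff (bmnm v.2) (q z).
apply: (@eq_rational_on _ _ _ f) => [z _|]; first by rewrite mcoeffM.
by apply: rational_on_sum => v _; apply: rational_onM; [exact: pD|exact: qD].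
Qed.

Lemma coeffs_rational_onC D f : rational_on D f ->
  coeffs_rational_on D (fun z => @mpolyC k K (f z)).
Proof.
move=> fD u; apply: eq_rational_on (rational_onM fD (rational_on_cst D _)) => z _.
by rewrite mcoeffC.
Qed.

Lemma coeffs_rational_on_sum (I : Type) (r : seq I) D
    (p : I -> 'rV[K]_n -> mpoly k K) :
  (forall l, coeffs_rational_on D (p l)) ->
  coeffs_rational_on D (fun z => \sum_(l <- r) p l z).
Proof.
move=> pD u; apply: eq_rational_on (rational_on_sum (P := xpredT) r
  (f := fun l z => mcoeff u (p l z)) (fun l _ => pD l u)) => z _.
by rewrite raddf_sum.
Qed.

Lemma coeffs_rational_on_prod (I : Type) (r : seq I) D
    (p : I -> 'rV[K]_n -> mpoly k K) :
  (forall l, coeffs_rational_on D (p l)) ->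
  coeffs_rational_on D (fun z => \prod_(l <- r) p l z).
Proof.
move=> pD; elim: r => [|l r IHr].
  rewrite (_ : (fun z => _) = fun=> 1); first exact: coeffs_rational_on_cst.
  by apply/funext => z; rewrite big_nil.
rewrite (_ : (fun z => _) = fun z => p l z * \prod_(l <- r) p l z).
  exact: coeffs_rational_onM.
by apply/funext => z; rewrite big_cons.
Qed.

Lemma coeffs_rational_onX D p l : coeffs_rational_on D p ->
  coeffs_rational_on D (fun z => p z ^+ l).
Proof.
move=> pD; rewrite (_ : (fun z => _) = fun z => \prod_(j < l) p z).
  by apply: coeffs_rational_on_prod.
by apply/funext => z; rewrite prodr_const card_ord.
Qed.

End CoefficientsRational.

Section ChainCoefficients.
Variables (K : numFieldType) (n m : nat) (Q : 'I_(n + m) -> ratfun K n).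
Local Notation rat := (@rat_of_mpoly K n).

Definition submersive_locus : set 'rV[K]_n :=
  [set z | ratmap_regular Q z /\ jacobian (param_r Q) z \in unitmx].
Local Notation D := submersive_locus.

Lemma open_ratmap_regular N (h : 'I_N -> ratfun K n) : open (ratmap_regular h).
Proof.
rewrite openE => z regz.
have near_reg j : \forall w \near z, regular rat (h j) w.
  exact: (open_nbhs_nbhs (conj (@open_regular K n (h j)) (regz j))).
exact: filter_forall near_reg.
Qed.

Lemma rational_on_param_r i : rational_on (ratmap_regular Q) (param_r Q i).
Proof.
apply: rational_on_sub (rational_on_value (Q (lshift m i))) => z.
exact.
Qed.

Lemma rational_on_jacobian i j :
  rational_on (ratmap_regular Q) (fun z => jacobian (param_r Q) z i j).
Proof.
have oR : open (ratmap_regular Q) by exact: open_ratmap_regular.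
apply: eq_rational_on (rational_on_partial j oR (rational_on_param_r i)) => z _.
by rewrite mxE.
Qed.

Lemma open_submersive_locus : open D.
Proof.
have oR : open (ratmap_regular Q) by exact: open_ratmap_regular.
have rdet := rational_on_det rational_on_jacobian.
rewrite openE => z [regz]; rewrite unitmxE unitfE => detz.
have cdet := differentiable_continuous (rational_on_diff oR rdet regz).
have near_det : \forall y \near z, \det (jacobian (param_r Q) y) != 0.
  exact: cvgr_neq0 cdet detz.
have near_reg : \forall y \near z, ratmap_regular Q y.
  exact: (open_nbhs_nbhs (conj oR regz)).
near=> y; split; first by near: y; exact: near_reg.
by rewrite unitmxE unitfE; near: y; exact: near_det.
Unshelve. all: by end_near. Qed.

Lemma rational_on_chain_step i c :
  (forall be, rational_on D (c be)) ->
  forall be, rational_on D (chain_step (param_r Q) i c be).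
Proof.
move=> Dc be; have oD := open_submersive_locus.
apply: rational_on_sum => j _; apply: rational_onM.
  apply: rational_on_invmx => [z [_ uz]|i' j']; first by rewrite unitmx_tr.
  apply: (@eq_rational_on _ _ _ (fun z => jacobian (param_r Q) z j' i')).
    by move=> z _; rewrite [RHS]mxE.
  by apply: rational_on_sub (rational_on_jacobian j' i') => z [].
apply: rational_onD; first exact: rational_on_partial.
case: (0 < be j)%N; first exact: Dc.
exact: rational_on_cst.
Qed.

Lemma rational_on_chain_coeff al be :
  rational_on D (chain_coeff (param_r Q) al be).
Proof.
move: be; rewrite /chain_coeff; apply: (multi_iter_ind
  (P := fun c => forall be, rational_on D (c be))) => [be|i c Dc be].
  exact: rational_on_cst.
exact: rational_on_chain_step.
Qed.

Lemma coeffs_rational_on_chain_form s al :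
  coeffs_rational_on D (fun z => chain_form s (param_r Q) z al).
Proof.
apply: coeffs_rational_on_sum => i u.
apply: (@eq_rational_on _ _ _ (fun z => chain_coeff (param_r Q) al (jet_index i) z *
    mcoeff u (mpolyX K (mnm1 i)))) => [z _|]; first by rewrite mcoeffZ.
apply: rational_onM; last exact: rational_on_cst.
exact: rational_on_chain_coeff.
Qed.

End ChainCoefficients.

Section PdeB.
Variables (K : numFieldType) (n m : nat) (T : radical_tower K n m).
Variables (U : set 'rV[K]_n) (d : 'rV[K]_n -> 'rV[K]_m).
Hypothesis branchUd : is_branch T U d.
Variable Q : 'I_(n + m) -> ratfun K n.
Hypothesis QV : rational_parametrization (tower_variety U d) Q.
Local Notation rat := (@rat_of_mpoly K n).

Let ker P : (tower_poly T P == 0) = (param_eval Q P == 0).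
Proof. exact: param_eval_ker (tower_vanishing_idealU branchUd) QV. Qed.

Let kerQT P : param_eval Q P = 0 -> tower_poly T P = 0.
Proof. by move/eqP; rewrite -ker => /eqP. Qed.

Let kerTQ P : tower_poly T P = 0 -> param_eval Q P = 0.
Proof. by move/eqP; rewrite ker => /eqP. Qed.

Lemma specializes_tower_param z : ratmap_regular Q z ->
  specializes (tower_poly T) (ratmap_value Q z).
Proof. by move=> regz P /kerTQ; exact: specializes_param_eval. Qed.

Lemma rational_on_tower_value (a : T) :
  rational_on [set z | ratmap_regular Q z /\
                       regular (tower_poly T) a (ratmap_value Q z)]
    (fun z => value (tower_poly T) a (ratmap_value Q z)).
Proof.
have [c ac] := is_fraction_transfer kerQT (tower_is_fraction a).
exists c => z [regz /regular_value av].
by apply: (has_value_param kerTQ regz ac).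
Qed.

Lemma pdeB_algebraic s (F : diffpoly T n s) : pde_algebraic (pdeB Q F).
Proof.
suff H : coeffs_rational_on (pde_dom (pdeB Q F)) (pde_at (pdeB Q F)) by [].
set E := pde_dom _.
(* The sum runs over the support of [F], which is independent of [z]; the support of
   [coeffs_value F] may shrink where a coefficient vanishes. *)
pose g z := \sum_(u <- msupp F)
  @mpolyC (njets n s) K (value (tower_poly T) (mcoeff u F) (ratmap_value Q z)) *
  \prod_i chain_form s (param_r Q) z (jet_index i) ^+ u i.
rewrite (_ : pde_at _ = g); last first.
  apply/funext => z; rewrite /= /coeffs_value /map_mpoly {2}/mmap.
  rewrite rmorph_sum; apply: eq_bigr => u _.
  by rewrite mmap1_id rmorphM /= mmapC mmapX.
have sE : E `<=` submersive_locus Q by move=> z [].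
apply: coeffs_rational_on_sum => u; apply: coeffs_rational_onM.
  apply: coeffs_rational_onC.
  by apply: rational_on_sub (rational_on_tower_value (mcoeff u F)) => z [].
apply: coeffs_rational_on_prod => i; apply: coeffs_rational_onX => v.
by apply: rational_on_sub sE _; exact: coeffs_rational_on_chain_form.
Qed.

End PdeB.

(** * Iterated partial derivatives *)

Section Words.
Variable n : nat.
Implicit Types (al : multinom n).

(** Flattening the nested iterations into one list turns commutation of derivatives into invariance
    under permutation. *)
Definition word al : seq 'I_n := flatten [seq nseq (al i) i | i <- enum 'I_n].

Lemma multi_iter_word (A : Type) (op : 'I_n -> A -> A) al t :
  multi_iter op al t = foldr op t (word al).
Proof.
rewrite /multi_iter /word; elim: (enum 'I_n) => //= i s ->.
by rewrite foldr_cat; elim: (al i) => //= k ->.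
Qed.

Lemma count_word a al : count a (word al) = (\sum_i a i * al i)%N.
Proof.
rewrite /word count_flatten -map_comp sumnE big_map big_enum.
by apply: eq_bigr => i _; rewrite /= count_nseq.
Qed.

Lemma size_word al : size (word al) = mdeg al.
Proof.
rewrite -count_predT count_word mdegE.
by apply: eq_bigr => i _; rewrite mul1n.
Qed.

Lemma perm_word_succ al i : perm_eq (word (mnm_add al (mnm1 i))) (i :: word al).
Proof.
apply/permP => a; rewrite /= !count_word.
rewrite (eq_bigr (fun k => (a k * al k + a k * (i == k))%N)); last first.
  by move=> k _; rewrite mnmDE mnm1E mulnDr.
rewrite big_split /= addnC; congr addn.
rewrite (bigD1 i) //= eqxx muln1 big1 ?addn0 // => k.
by rewrite eq_sym => /negbTE ->; rewrite muln0.
Qed.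

Lemma sum_jet_index (A : nmodType) s (f : multinom n -> A) :
  \sum_(i < njets n s) f (jet_index i) = \sum_(be : bmultinom n s.+1) f (bmnm be).
Proof.
by rewrite -(big_enum_val (A := {: bmultinom n s.+1}) (fun be => f (bmnm be))).
Qed.

(** Reindexing by adding one to the entry [j]. The shift could leave the bounded range at the top,
    where [c] vanishes by hypothesis; it misses the indices with entry 0 at [j], whence the
    conditional. *)
Lemma sum_multinom_shift (K : comNzRingType) B k (c y : multinom n -> K) j :
  (k.+1 < B)%N -> (forall be, (k < mdeg be)%N -> c be = 0) ->
  \sum_(be : bmultinom n B) c (bmnm be) * y (mnm_add (bmnm be) (mnm1 j)) =
  \sum_(be : bmultinom n B)
    (if (0 < bmnm be j)%N then c (mnm_sub (bmnm be) (mnm1 j)) else 0) * y (bmnm be).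
Proof.
(* The graph of the shift, as a 0-1 matrix: the reindexing becomes an exchange of two sums. *)
move=> kB c0; pose e (be be' : bmultinom n B) : K :=
  (mnm_add (bmnm be) (mnm1 j) == bmnm be')%:R.
have L (be : bmultinom n B) : c (bmnm be) * y (mnm_add (bmnm be) (mnm1 j)) =
    \sum_(be' : bmultinom n B) e be be' * (c (bmnm be) * y (bmnm be')).
  have [kbe|bek] := ltnP k (mdeg (bmnm be)).
    by rewrite c0 // mul0r big1 // => be' _; rewrite mul0r mulr0.
  have lt : (mdeg (mnm_add (bmnm be) (mnm1 j)) < B)%N.
    by rewrite mdegD mdeg1 addn1 (leq_ltn_trans _ kB).
  rewrite (bigD1 (BMultinom lt)) //= {1}/e /= eqxx mul1r big1 ?addr0 // => be' ne.
  rewrite /e; case: eqP => [E|]; last by rewrite mul0r.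
  by case/eqP: ne; apply/val_inj; rewrite /= E.
rewrite (eq_bigr _ (fun be _ => L be)) exchange_big; apply: eq_bigr => be' _.
case: ifP => [j0|j0].
  have be'K : mnm_add (mnm_sub (bmnm be') (mnm1 j)) (mnm1 j) = bmnm be'.
    rewrite submK //; apply/mnm_lepP => l; rewrite mnm1E.
    by case: eqP => // <-.
  have lt : (mdeg (mnm_sub (bmnm be') (mnm1 j)) < B)%N.
    apply: leq_ltn_trans (bmdeg be'); rewrite -[in leqRHS]be'K mdegD.
    exact: leq_addr.
  rewrite (bigD1 (BMultinom lt)) //= {1}/e /= be'K eqxx mul1r.
  rewrite big1 ?addr0 // => be ne; rewrite /e; case: eqP => [E|]; last by rewrite mul0r.
  by case/eqP: ne; apply/val_inj; rewrite /= -E addmK.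
rewrite mul0r big1 // => be _; rewrite /e; case: eqP => [E|]; last by rewrite mul0r.
by move: j0; rewrite -E mnmDE mnm1E eqxx addn1.
Qed.

End Words.

Section Holomorphic.
Variables (K : numFieldType) (n : nat).
Implicit Types (D : set 'rV[K]_n) (f g : 'rV[K]_n -> K).

Lemma holomorphic_foldr D f s :
  holomorphic_on D f -> holomorphic_on D (foldr (@partial K n) f s).
Proof.
by move=> hf; elim: s => //= i s; exact: holomorphic_partial.
Qed.

Lemma partial_perm D f s t x : derivatives_commute K -> open D ->
  holomorphic_on D f -> perm_eq s t -> D x ->
  foldr (@partial K n) f s x = foldr (@partial K n) f t x.
Proof.
move=> dK oD hf.
(* Any letter can be moved to the front, one transposition at a time. Equalities on the open set [D]
   may be differentiated, which carries the induction through. *)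
have front i s1 s2 y : D y -> foldr (@partial K n) f (s1 ++ i :: s2) y =
    partial i (foldr (@partial K n) f (s1 ++ s2)) y.
  elim: s1 y => // l s1 IHs1 y Dy /=.
  rewrite (near_eq_partial l (open_near_eq oD Dy IHs1)).
  set F := foldr _ _ _; have hF : holomorphic_on D F by exact: holomorphic_foldr.
  apply: partial_comm => //.
  - apply: filterS (open_nbhs_nbhs (conj oD Dy)) => w; exact: holomorphic_diff.
  - exact: holomorphic_diff (holomorphic_partial i hF) Dy.
  - exact: holomorphic_diff (holomorphic_partial l hF) Dy.
elim: s t x => [|i s IHs] t x.
  by rewrite perm_sym => /perm_nilP ->.
move=> st Dx; have it : i \in t by rewrite -(perm_mem st) mem_head.
case/splitPr: it st => t1 t2.
rewrite perm_sym -(cat1s i t2) perm_catCA perm_cons perm_sym => st.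
rewrite front //=; apply: near_eq_partial; apply: (open_near_eq oD Dx) => y Dy.
exact: IHs.
Qed.

Lemma multi_iter_partial_succ D f be j x : derivatives_commute K -> open D ->
  holomorphic_on D f -> D x ->
  partial j (multi_iter (@partial K n) be f) x =
  multi_iter (@partial K n) (mnm_add be (mnm1 j)) f x.
Proof.
move=> dK oD hf Dx; rewrite !multi_iter_word.
by rewrite (partial_perm dK oD hf (perm_word_succ be j) Dx).
Qed.

Lemma holomorphic_multi_iter D f be :
  holomorphic_on D f -> holomorphic_on D (multi_iter (@partial K n) be f).
Proof. by move=> hf; rewrite multi_iter_word; exact: holomorphic_foldr. Qed.

Lemma holomorphic_sub D D' f :
  D' `<=` D -> holomorphic_on D f -> holomorphic_on D' f.
Proof. by move=> sD hf s x /sD; exact: hf. Qed.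

Lemma eq_holomorphic D f g : open D -> (forall x, D x -> f x = g x) ->
  holomorphic_on D f -> holomorphic_on D g.
Proof.
move=> oD fg /holomorphic_smooth sf; apply/holomorphic_smooth => k.
exact: eq_smooth oD fg (sf k).
Qed.

Lemma holomorphic_cst D c : holomorphic_on D (fun=> c).
Proof. by apply/holomorphic_smooth => k; exact: smooth_cst. Qed.

Lemma holomorphicM D f g : open D ->
  holomorphic_on D f -> holomorphic_on D g -> holomorphic_on D (fun x => f x * g x).
Proof.
move=> oD /holomorphic_smooth sf /holomorphic_smooth sg.
by apply/holomorphic_smooth => k; exact: smoothM.
Qed.

Lemma holomorphic_sum D (I : Type) (r : seq I) (P : pred I)
    (f : I -> 'rV[K]_n -> K) :
  open D -> (forall l, P l -> holomorphic_on D (f l)) ->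
  holomorphic_on D (fun x => \sum_(l <- r | P l) f l x).
Proof.
move=> oD hf; apply/holomorphic_smooth => k; apply: smooth_sum => // l Pl.
by have /holomorphic_smooth := hf l Pl.
Qed.

Lemma holomorphic_prod D (I : Type) (r : seq I) (f : I -> 'rV[K]_n -> K) :
  open D -> (forall l, holomorphic_on D (f l)) ->
  holomorphic_on D (fun x => \prod_(l <- r) f l x).
Proof.
move=> oD hf; elim: r => [|l r IHr].
  by refine (eq_holomorphic oD _ (@holomorphic_cst D 1)) => x _; rewrite big_nil.
by refine (eq_holomorphic oD _ (holomorphicM oD (hf l) IHr)) => x _; rewrite big_cons.
Qed.

Lemma holomorphicX D f k : open D ->
  holomorphic_on D f -> holomorphic_on D (fun x => f x ^+ k).
Proof.
move=> oD hf; elim: k => [|k IHk].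
  by refine (eq_holomorphic oD _ (@holomorphic_cst D 1)) => x _; rewrite expr0.
by refine (eq_holomorphic oD _ (holomorphicM oD hf IHk)) => x _; rewrite exprS.
Qed.

Lemma holomorphic_continuous D f x :
  holomorphic_on D f -> D x -> {for x, continuous f}.
Proof. by move=> hf Dx; apply/differentiable_continuous/(holomorphic_diff hf). Qed.

End Holomorphic.

(** * The inverse parametrization *)

Section RatEquality.
Variables (K : numFieldType) (n : nat).
Local Notation rat := (@rat_of_mpoly K n).

Lemma eq_ratfun_on_open (W : set 'rV[K]_n) (a b : ratfun K n) f :
  open W -> W !=set0 -> (forall z, W z -> has_value rat a z (f z)) ->
  (forall z, W z -> has_value rat b z (f z)) -> a = b.
Proof.
move=> oW W0 af bf; apply/eqP; rewrite -subr_eq0; apply/eqP.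
have [p [q [q0 abE _ _]]] := rat_is_fraction (a - b).
(* The values determine [p] only where [q] is nonzero; the product vanishes everywhere on [W]. *)
have pq0 : p * q = 0.
  apply: (mpoly_vanishing_open oW W0) => z Wz; rewrite mevalM.
  have [->|qz] := eqVneq (meval (z 0) q) 0; first by rewrite mulr0.
  have ab0 : has_value rat (a - b) z 0.
    by rewrite -(subrr (f z)); apply: transferB; [exact: af|exact: bf].
  have abpq : has_value rat (a - b) z (meval (z 0) p / meval (z 0) q).
    by rewrite abE; exact: has_value_frac.
  have /eqP := has_value_uniq (@rat_specializes _ _ z) abpq ab0.
  by rewrite mulf_eq0 invr_eq0 (negbTE qz) orbF => /eqP ->; rewrite mul0r.
rewrite abE; apply/eqP; rewrite mulf_eq0 invr_eq0 (negbTE q0) orbF.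
move/eqP: pq0; rewrite mulf_eq0 -!rat_of_mpoly_eq0 (negbTE q0) orbF.
exact.
Qed.

Lemma param_eval_coord (q : mpoly n K) :
  param_eval (fun l => rat (mpolyX K (mnm1 l))) q = rat q.
Proof.
rewrite {2}(mpolyE q) rmorph_sum; apply: eq_bigr => u _.
rewrite -mul_mpolyC rmorphM mpolyXE_id rmorph_prod; congr (_ * _).
by apply: eq_bigr => l _; rewrite rmorphXn.
Qed.

End RatEquality.

Section Inverse.
Variables (K : numFieldType) (n m : nat) (T : radical_tower K n m).
Variables (U : set 'rV[K]_n) (d : 'rV[K]_n -> 'rV[K]_m).
Hypothesis branchUd : is_branch T U d.
Variables (Q : 'I_(n + m) -> ratfun K n) (h : 'I_n -> ratfun K (n + m)).
Hypothesis QV : rational_parametrization (tower_variety U d) Q.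
Hypothesis hQ : birational_inverse (tower_variety U d) Q h.
Local Notation psi := (tower_point d).
Local Notation ratN := (@rat_of_mpoly K (n + m)).
Local Notation rat := (@rat_of_mpoly K n).

Definition pullback_point (x : 'rV[K]_n) : 'rV[K]_n := ratmap_value h (psi x).
Local Notation g := pullback_point.

Definition pullback_dom : set 'rV[K]_n :=
  [set x | U x /\ ratmap_regular h (psi x)].

Let oU : open U. Proof. exact: branch_open branchUd. Qed.

Lemma tower_variety_point x : U x -> tower_variety U d (psi x).
Proof. by move=> Ux; apply: zariski_closure_sub; exists x. Qed.

Lemma tower_variety_specializes w :
  tower_variety U d w -> specializes (tower_poly T) w.
Proof.
by move=> Vw P P0; apply: Vw => _ [x Ux <-]; exact: (branch_relations branchUd P0).
Qed.

Lemma tower_point_specializes x : U x -> specializes (tower_poly T) (psi x).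
Proof. by move=> Ux; exact/tower_variety_specializes/tower_variety_point. Qed.

Lemma holomorphic_tower_point l : holomorphic_on U (fun x => psi x 0 l).
Proof.
rewrite (_ : (fun x => _) = match fintype.split l with
  inl i => fun x : 'rV[K]_n => x 0 i | inr j => fun x => d x 0 j end); last first.
  by apply/funext => x; rewrite mxE; case: (fintype.split l).
case: (fintype.split l) => i; last exact: branch_holomorphic branchUd i.
apply: rational_on_holomorphic => //.
apply: eq_rational_on (rational_on_meval U (mpolyX K (mnm1 i))) => x _.
by rewrite mevalXU.
Qed.

Lemma differentiable_tower_point x : U x -> differentiable psi x.
Proof.
move=> Ux; apply: differentiable_rV => l.
exact: holomorphic_diff (holomorphic_tower_point l) Ux.
Qed.

Lemma open_preimage N (D : set 'rV[K]_n) (E : set 'rV[K]_N)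
    (f : 'rV[K]_n -> 'rV[K]_N) : open D -> open E ->
  (forall x, D x -> differentiable f x) -> open [set x | D x /\ E (f x)].
Proof.
move=> oD oE df; rewrite openE => x [Dx Efx].
have nD : \forall y \near x, D y by exact: (open_nbhs_nbhs (conj oD Dx)).
have nE : \forall y \near x, E (f y).
  have /= := differentiable_continuous (df x Dx).
  by apply; exact: (open_nbhs_nbhs (conj oE Efx)).
by near=> y; split; near: y.
Unshelve. all: by end_near. Qed.

Lemma open_pullback_dom : open pullback_dom.
Proof.
apply: open_preimage oU _ differentiable_tower_point.
exact: open_ratmap_regular.
Qed.

Lemma holomorphic_pullback_point j :
  holomorphic_on pullback_dom (fun x => g x 0 j).
Proof.
have oE : open (ratmap_regular h) by exact: open_ratmap_regular.
have hE : holomorphic_on (ratmap_regular h) (value ratN (h j)).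
  apply: rational_on_holomorphic => //.
  by apply: rational_on_sub (rational_on_value (h j)) => w; apply.
have pE x : pullback_dom x -> ratmap_regular h (psi x) by case.
have hpsi l : holomorphic_on pullback_dom (fun x => psi x 0 l).
  by apply: (holomorphic_sub _ (holomorphic_tower_point l)) => x [].
have := holomorphic_comp open_pullback_dom pE hE hpsi.
by rewrite (_ : value ratN (h j) \o psi = fun x => g x 0 j) //;
  apply/funext => x; rewrite mxE.
Qed.

Lemma differentiable_pullback_point x : pullback_dom x -> differentiable g x.
Proof.
move=> Dx; apply: differentiable_rV => j.
exact: holomorphic_diff (holomorphic_pullback_point j) Dx.
Qed.

Let kerQT P : param_eval Q P = 0 -> tower_poly T P = 0.
Proof.
by move/eqP; rewrite -(param_eval_ker _ (tower_vanishing_idealU branchUd) QV) => /eqP.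
Qed.

Let kerTQ P : tower_poly T P = 0 -> param_eval Q P = 0.
Proof.
by move/eqP; rewrite (param_eval_ker _ (tower_vanishing_idealU branchUd) QV) => /eqP.
Qed.

Lemma ratN_ker (L : fieldType) (i : {rmorphism mpoly (n + m) K -> L}) p :
  ratN p = 0 -> i p = 0.
Proof. by move/eqP; rewrite rat_of_mpoly_eq0 => /eqP ->; rewrite rmorph0. Qed.

(** A denominator of [h j] that is nonzero at one point of the variety is not a relation between x
    and delta, so [h j] can be read in F_m. *)
Lemma exists_tower_inverse :
  exists hbar : 'I_n -> T, forall j, transfer ratN (tower_poly T) (h j) (hbar j).
Proof.
have [hreg _ _] := hQ.
suff /choice[hbar H] j : exists a, transfer ratN (tower_poly T) (h j) a.
  by exists hbar.
have [w Vw [_ [p [q [q0 hE qw _]]]]] := hreg j.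
exists (tower_poly T p / tower_poly T q), p, q; split=> //.
apply: contra qw => /eqP q0'; apply/eqP.
exact: (tower_variety_specializes Vw).
Qed.

Section Hbar.
Variable hbar : 'I_n -> T.
Hypothesis hbarE : forall j, transfer ratN (tower_poly T) (h j) (hbar j).

Lemma has_value_hbar x j : pullback_dom x ->
  has_value (tower_poly T) (hbar j) (psi x) (g x 0 j).
Proof.
move=> [Ux regx]; rewrite mxE; have hv := regular_value (regx j).
exact: (transfer_comp (@ratN_ker _ (tower_poly T)) (hbarE j) hv
  (tower_point_specializes Ux)).
Qed.

(** This is h(Q(z)) = z as an identity in C(z). It is checked on the open set where both sides have
    values; that set is nonempty because the denominators of [h] are nonzero in F_m and so do not
    all vanish along [Q]. *)
Lemma transfer_hbar j :
  transfer (tower_poly T) (param_eval Q) (hbar j) (rat (mpolyX K (mnm1 j))).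
Proof.
have [_ hQz _] := hQ.
have /choice[pq pqE] l : exists pq : mpoly (n + m) K * mpoly (n + m) K,
    [/\ ratN pq.2 != 0, tower_poly T pq.2 != 0 & h l = ratN pq.1 / ratN pq.2].
  by have [p [q [? ? ? _]]] := hbarE l; exists (p, q).
have [c hc] : exists c, transfer (tower_poly T) (param_eval Q) (hbar j) c.
  by apply: is_fraction_transfer kerQT _; exact: tower_is_fraction.
suff -> : rat (mpolyX K (mnm1 j)) = c by [].
have oR : open (ratmap_regular Q) by exact: open_ratmap_regular.
have oE : open (ratmap_regular h) by exact: open_ratmap_regular.
pose W := [set z | ratmap_regular Q z /\ ratmap_regular h (ratmap_value Q z)].
have oW : open W.
  apply: (open_preimage oR oE) => z regz; apply: differentiable_rV => l.
  rewrite (_ : (fun y => _) = value rat (Q l)); last first.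
    by apply/funext => y; rewrite mxE.
  have rQ : rational_on (ratmap_regular Q) (value rat (Q l)).
    by apply: rational_on_sub (rational_on_value (Q l)) => w; apply.
  exact: rational_on_diff oR rQ regz.
have W0 : W !=set0.
  have : tower_poly T (\prod_l (pq l).2) != 0.
    by rewrite rmorph_prod; apply/prodf_neq0 => l _; have [] := pqE l.
  move=> P0; apply: contrapT => nW; move/eqP: P0; apply; apply: kerQT.
  apply/param_eval_eq0 => _ [z regz <-]; apply/eqP/negPn/negP => Pz.
  apply: nW; exists z; split=> // l; have [ql _ hl] := pqE l.
  exists (meval (ratmap_value Q z 0) (pq l).1 / meval (ratmap_value Q z 0) (pq l).2).
  exists (pq l).1, (pq l).2; split=> //.
  by move: Pz; rewrite rmorph_prod => /prodf_neq0; apply.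
apply: (eq_ratfun_on_open (f := fun z => z 0 j) oW W0) => z [regz reghz].
  rewrite has_valueE (_ : z 0 j = meval (z 0) (mpolyX K (mnm1 j))); last first.
    by rewrite mevalXU.
  exact: transfer_image.
apply: (has_value_param kerTQ regz hc).
have spz := specializes_tower_param branchUd QV regz.
have <- : ratmap_value h (ratmap_value Q z) 0 j = z 0 j by rewrite hQz.
rewrite mxE; have hv := regular_value (reghz j).
exact: (transfer_comp (@ratN_ker _ (tower_poly T)) (hbarE j) hv spz).
Qed.

(* [x |-> g x] is dominant: the embedding of F_m into C(z) sends [q(hbar)] to
   [q], by [transfer_hbar], so that [q(hbar)] is not zero. *)
Lemma pullback_meval_neq0 (W : set 'rV[K]_n) (q : mpoly n K) :
  W `<=` pullback_dom -> open W -> W !=set0 -> q != 0 ->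
  exists2 x, W x & meval (g x 0) q != 0.
Proof.
move=> WD oW W0 q0.
have WU : W `<=` U by move=> x /WD [].
have iW := tower_vanishing_ideal branchUd WU oW W0.
set b := mmap (fun x => tower_poly T (@mpolyC (n + m) K x)) hbar q.
have b0 : b != 0.
  apply: contra q0 => /eqP b0.
  have := transfer_mmap (@mpolyC (n + m) K) q transfer_hbar.
  rewrite -/b b0 => /(transfer_eq0 kerTQ) E.
  rewrite -rat_of_mpoly_eq0 -param_eval_coord -E; apply/eqP.
  by apply: eq_bigr => u _; rewrite /= param_evalC.
have [N [M [M0 bE _ _]]] := tower_is_fraction b.
have N0 : tower_poly T N != 0.
  by apply: contra b0 => /eqP N0; rewrite bE /= N0 mul0r.
have NM0 : tower_poly T (N * M) != 0 by rewrite rmorphM mulf_neq0.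
have [_ [x Wx <-]] := vanishing_ideal_nonzero iW NM0.
rewrite mevalM mulf_eq0 negb_or => /andP[Nx Mx]; exists x => //.
have bq : has_value (tower_poly T) b (psi x) (meval (g x 0) q).
  by apply: has_value_mmap => j; apply: has_value_hbar; exact: WD.
have bNM : has_value (tower_poly T) b (psi x)
    (meval (psi x 0) N / meval (psi x 0) M) by exists N, M.
have spx := tower_point_specializes (WU _ Wx).
by rewrite (has_value_uniq spx bq bNM) mulf_neq0 ?invr_eq0.
Qed.

End Hbar.

(** [W] being arbitrary, this is a density statement; dominance is applied to the product of the
    denominators of [Q]. *)
Lemma pullback_regular (W : set 'rV[K]_n) :
  W `<=` pullback_dom -> open W -> W !=set0 ->
  exists2 x, W x & ratmap_regular Q (g x).
Proof.
move=> WD oW W0; have [hbar hbarE] := exists_tower_inverse.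
have /choice[pq pqE] l : exists pq : mpoly n K * mpoly n K,
    rat pq.2 != 0 /\ Q l = rat pq.1 / rat pq.2.
  by have [p [q [? ? _ _]]] := rat_is_fraction (Q l); exists (p, q).
have q0 : \prod_l (pq l).2 != 0.
  by apply/prodf_neq0 => l _; rewrite -rat_of_mpoly_eq0; have [] := pqE l.
have [x Wx qx] := pullback_meval_neq0 hbarE WD oW W0 q0.
exists x => // l; have [ql Ql] := pqE l.
exists (meval (g x 0) (pq l).1 / meval (g x 0) (pq l).2), (pq l).1, (pq l).2.
by split=> //; move: qx; rewrite rmorph_prod => /prodf_neq0; apply.
Qed.

End Inverse.

Lemma partial_sum (K : numFieldType) n (I : Type) (r : seq I)
    (f : I -> 'rV[K]_n -> K) x :
  (forall l, differentiable (f l) x) ->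
  differentiable (fun y => \sum_(l <- r) f l y) x /\
  forall i, partial i (fun y => \sum_(l <- r) f l y) x =
            \sum_(l <- r) partial i (f l) x.
Proof.
move=> df; elim: r => [|l r [dr Er]].
  rewrite (_ : (fun y => _) = fun=> 0); last by apply/funext => y; rewrite big_nil.
  by split=> [|i]; [exact: differentiable_cst|rewrite partial_cst big_nil].
rewrite (_ : (fun y => _) = fun y => f l y + \sum_(l <- r) f l y); last first.
  by apply/funext => y; rewrite big_cons.
split=> [|i]; first exact: differentiableD.
by rewrite partialD // Er big_cons.
Qed.

Lemma meval_mmapC (K : numFieldType) k l (v : 'I_l -> K) (q : 'I_k -> mpoly l K) p :
  meval v (mmap (@mpolyC l K) q p) = meval (fun i => meval v (q i)) p.
Proof.
rewrite rmorph_sum mevalE; apply: eq_bigr => u _.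
rewrite rmorphM /= mevalC rmorph_prod; congr (_ * _).
by apply: eq_bigr => i _; rewrite rmorphXn.
Qed.

(** * The chain rule and the solutions of (A) *)

Section ChainRule.
Variables (K : numFieldType) (n m s : nat) (T : radical_tower K n m).
Variables (U : set 'rV[K]_n) (d : 'rV[K]_n -> 'rV[K]_m).
Hypothesis branchUd : is_branch T U d.
Variables (Q : 'I_(n + m) -> ratfun K n) (h : 'I_n -> ratfun K (n + m)).
Hypothesis QV : rational_parametrization (tower_variety U d) Q.
Hypothesis hQ : birational_inverse (tower_variety U d) Q h.
Hypothesis dK : derivatives_commute K.
Variables (Omega : set 'rV[K]_n) (Y : 'rV[K]_n -> K).
Hypotheses (oOmega : open Omega) (holY : holomorphic_on Omega Y).
Local Notation psi := (tower_point d).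
Local Notation g := (pullback_point d h).
Local Notation r := (param_r Q).

Definition regular_pullback_dom : set 'rV[K]_n :=
  [set x | pullback_dom U d h x /\ ratmap_regular Q (g x)].
Local Notation Dr := regular_pullback_dom.

Lemma open_regular_pullback_dom : open Dr.
Proof.
apply: open_preimage; first exact: open_pullback_dom branchUd h.
  exact: open_ratmap_regular.
by move=> x; exact: differentiable_pullback_point branchUd h x.
Qed.

Lemma param_pullback x : Dr x -> ratmap_value Q (g x) = psi x.
Proof.
have [_ _ Qh] := hQ; move=> [[Ux regh] regQ]; apply: Qh => //.
by apply: zariski_closure_sub; exists x.
Qed.

Lemma param_r_pullback x i : Dr x -> r i (g x) = x 0 i.
Proof.
move=> /param_pullback /(congr1 (fun w : 'rV_(n + m) => w 0 (lshift m i))).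
by rewrite mxE row_mxEl.
Qed.

(** The identity r(g(x)) = x holds on an open set and is differentiated there. *)
Lemma jacobian_pullback x : Dr x ->
  jacobian r (g x) *m \matrix_(j, i) partial i (fun y => g y 0 j) x = 1%:M.
Proof.
move=> Dx; have [Px regQ] := Dx; apply/matrixP => i i'; rewrite !mxE.
have oR : open (ratmap_regular Q) by exact: open_ratmap_regular.
have dg := differentiable_pullback_point branchUd Px.
have dr : differentiable (r i) (g x).
  exact: rational_on_diff oR (rational_on_param_r Q i) regQ.
rewrite eq_sym -(partial_coord i i' x).
rewrite -(near_eq_partial i' (open_near_eq open_regular_pullback_dom Dx
  (fun y Dy => param_r_pullback i Dy))).
rewrite (partial_comp i' dg dr); apply: eq_bigr => j _.
by rewrite !mxE.
Qed.

Lemma jacobian_pullback_unit x : Dr x -> jacobian r (g x) \in unitmx.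
Proof. by move=> /jacobian_pullback/mulmx1_unit[]. Qed.

Lemma partial_pullback x i j : Dr x ->
  partial i (fun y => g y 0 j) x = invmx (jacobian r (g x))^T i j.
Proof.
move=> Dx; have uJ := jacobian_pullback_unit Dx.
have /(congr1 (mulmx (invmx (jacobian r (g x))))) := jacobian_pullback Dx.
rewrite mulKmx // mulmx1 -trmx_inv mxE => <-.
by rewrite mxE.
Qed.

(* The bound [k] on the multi-indices that occur in [c] ensures that a further
   derivative does not leave the range of summation. *)
Definition chain_represents (k : nat) (phi : 'rV[K]_n -> K)
    (c : multinom n -> 'rV[K]_n -> K) : Prop :=
  [/\ forall be, (k < mdeg be)%N -> c be = fun=> 0,
      forall be, rational_on (submersive_locus Q) (c be)
    & forall x, Dr x -> Omega (g x) ->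
        phi x = \sum_(be : bmultinom n s.+1)
          c (bmnm be) (g x) * multi_iter (@partial K n) (bmnm be) Y (g x)].

(** By the product rule, differentiating a coefficient gives the first term of [chain_step], and
    differentiating Y_be raises [be] by one, which reindexing turns into the second term. *)
Lemma chain_represents_step k phi c i : (k < s)%N ->
  chain_represents k phi c ->
  chain_represents k.+1 (partial i phi) (chain_step r i c).
Proof.
move=> ks [c0 rc E]; split.
- move=> be kbe; apply/funext => z; rewrite /chain_step big1 // => j _.
  rewrite c0; last exact: ltnW.
  rewrite partial_cst add0r; case: ifP => [bej|_]; last by rewrite mulr0.
  rewrite c0 ?mulr0 // -ltnS; apply: leq_trans kbe _.
  have -> : be = mnm_add (mnm_sub be (mnm1 j)) (mnm1 j).
    by rewrite submK //; apply/mnm_lepP => l; rewrite mnm1E; case: eqP => // <-.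
  by rewrite mdegD mdeg1 addn1 addmK.
- by move=> be; exact: rational_on_chain_step.
move=> x Dx Ox; have [Px regQ] := Dx.
pose Yd be := multi_iter (@partial K n) be Y.
pose G z := \sum_(be : bmultinom n s.+1) c (bmnm be) z * Yd (bmnm be) z.
have oD : open [set x | Dr x /\ Omega (g x)].
  apply: open_preimage open_regular_pullback_dom oOmega _ => y [Py _].
  exact: (differentiable_pullback_point branchUd Py).
have Lz : submersive_locus Q (g x) by split=> //; exact: jacobian_pullback_unit.
have oL : open (submersive_locus Q) by exact: open_submersive_locus.
have dc be : differentiable (c be) (g x) by exact: (rational_on_diff oL (rc be) Lz).
have dY be : differentiable (Yd be) (g x).
  exact: (holomorphic_diff (holomorphic_multi_iter be holY) Ox).
have [dG EG] := partial_sum (index_enum {: bmultinom n s.+1})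
  (fun be => differentiableM (dc (bmnm be)) (dY (bmnm be))).
have dg := differentiable_pullback_point branchUd Px.
have -> : partial i phi x = \sum_j partial j G (g x) *
    invmx (jacobian r (g x))^T i j.
  have phiG y : [set x | Dr x /\ Omega (g x)] y -> phi y = (G \o g) y.
    by move=> [Dy Oy]; exact: E.
  have := near_eq_partial i (open_near_eq oD (conj Dx Ox) phiG).
  move=> ->; rewrite partial_comp //; apply: eq_bigr => j _.
  by rewrite partial_pullback.
under [RHS]eq_bigr do rewrite /chain_step big_distrl.
rewrite exchange_big; apply: eq_bigr => j _.
rewrite mulrC; under [RHS]eq_bigr do rewrite /= -mulrA mulrDl.
rewrite -big_distrr big_split /=; congr (_ * _).
(* The assumption [k < s] keeps the raised multi-indices within order [s]. *)
rewrite -(sum_multinom_shift (k := k) (c := c^~ (g x)) (Yd^~ (g x))) //; last first.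
  by move=> be kbe; rewrite c0.
rewrite EG addrC -big_split; apply: eq_bigr => be _.
rewrite partialM //; congr (_ * _ + _); last by rewrite mulrC.
exact: (multi_iter_partial_succ (bmnm be) j dK oOmega holY Ox).
Qed.

Lemma chain_represents_word (w : seq 'I_n) : (size w <= s)%N ->
  chain_represents (size w) (foldr (@partial K n) (Y \o g) w)
    (foldr (chain_step r) (fun be _ => (be == mnm0)%:R) w).
Proof.
elim: w => [_|i w IHw ws]; last first.
  by apply: chain_represents_step => //; apply: IHw; exact: ltnW.
split=> [be be0|be|x Dx Ox].
- by apply/funext => z /=; case: eqP be0 => // ->; rewrite mdeg0.
- exact: rational_on_cst.
have lt0 : (mdeg (@mnm0 n) < s.+1)%N by rewrite mdeg0.
rewrite (bigD1 (BMultinom lt0)) //= eqxx mul1r big1 ?addr0.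
  by rewrite multi_iter_word (_ : word mnm0 = [::]) //; apply: size0nil;
    rewrite size_word mdeg0.
move=> be ne; case: eqP => [E|]; last by rewrite mul0r.
by case/eqP: ne; apply/val_inj.
Qed.

Lemma jet_pullback x i : Dr x -> Omega (g x) ->
  jet (s := s) (Y \o g) x i =
  meval (jet Y (g x)) (chain_form s r (g x) (jet_index i)).
Proof.
move=> Dx Ox; rewrite /jet multi_iter_word.
have si : (size (word (jet_index i)) <= s)%N by rewrite size_word -ltnS bmdeg.
have [_ _ ->//] := chain_represents_word si.
rewrite rmorph_sum; apply: (etrans (esym (sum_jet_index s (fun be =>
  foldr (chain_step r) (fun be _ => (be == mnm0)%:R) (word (jet_index i)) be (g x) *
  multi_iter (@partial K n) be Y (g x))))).
apply: eq_bigr => j _.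
by rewrite /= mevalZ mevalXU /jet /chain_coeff -multi_iter_word.
Qed.

Variable F : diffpoly T n s.
Hypothesis solB : forall z, Omega z -> pde_dom (pdeB Q F) z ->
  meval (jet Y z) (pde_at (pdeB Q F) z) = 0.

Lemma pdeA_regular_point x : Dr x -> Omega (g x) ->
  coeffs_regular F (psi x) ->
  meval (jet (Y \o g) x) (coeffs_value F (psi x)) = 0.
Proof.
move=> Dx Ox regF; have Qz := param_pullback Dx.
rewrite -[RHS](solB Ox); last first.
  split; [by case: Dx|exact: jacobian_pullback_unit|by rewrite Qz].
rewrite /= meval_mmapC Qz; apply: meval_eq => i.
exact: jet_pullback.
Qed.

End ChainRule.

Lemma open_neq0 (K : numFieldType) n (W : set 'rV[K]_n) e : open W ->
  holomorphic_on W e -> open [set x | W x /\ e x != 0].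
Proof.
move=> oW he; rewrite openE => x [Wx ex].
have nW : \forall y \near x, W y by exact: (open_nbhs_nbhs (conj oW Wx)).
have ne : \forall y \near x, e y != 0.
  by have ce := holomorphic_continuous he Wx; exact: cvgr_neq0 ce ex.
by near=> y; split; near: y.
Unshelve. all: by end_near. Qed.

Lemma meval_coeffs_value (K : numFieldType) n m s (T : radical_tower K n m)
    (F : diffpoly T n s) w v :
  meval v (coeffs_value F w) = \sum_(u <- msupp F)
    value (tower_poly T) (mcoeff u F) w * \prod_i v i ^+ u i.
Proof.
rewrite /coeffs_value /map_mpoly /mmap rmorph_sum; apply: eq_bigr => u _.
by rewrite mmap1_id rmorphM /= mevalC mevalX.
Qed.

(** * Solutions of (A) on the whole domain of the pullback *)

Section Solution.
Variables (K : numFieldType) (n m s : nat) (T : radical_tower K n m).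
Variables (U : set 'rV[K]_n) (d : 'rV[K]_n -> 'rV[K]_m).
Hypothesis branchUd : is_branch T U d.
Variables (Q : 'I_(n + m) -> ratfun K n) (h : 'I_n -> ratfun K (n + m)).
Hypothesis QV : rational_parametrization (tower_variety U d) Q.
Hypothesis hQ : birational_inverse (tower_variety U d) Q h.
Hypothesis dK : derivatives_commute K.
Local Notation psi := (tower_point d).
Local Notation g := (pullback_point d h).

Lemma pullback_solution (F : diffpoly T n s) (Omega : set 'rV[K]_n) Y :
  pde_solution (pdeB Q F) Omega Y ->
  pde_solution (pdeA U d F)
    [set x | [/\ U x, ratmap_regular h (psi x) & Omega (g x)]]
    (fun x => Y (g x)).
Proof.
move=> [oOmega holY solB].
have -> : [set x | [/\ U x, ratmap_regular h (psi x) & Omega (g x)]] =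
    [set x | pullback_dom U d h x /\ Omega (g x)].
  by apply/seteqP; split=> x /= => [[? ? ?]|[[? ?] ?]].
set D := [set x | _ /\ _].
have oP : open (pullback_dom U d h) by exact (@open_pullback_dom _ _ _ _ _ _ branchUd h).
have oD : open D.
  apply: (open_preimage oP oOmega) => x Px.
  exact: (differentiable_pullback_point branchUd Px).
have DP : D `<=` pullback_dom U d h by move=> x [].
have holf : holomorphic_on D (Y \o g).
  have DO x : D x -> Omega (g x) by case.
  have hg j : holomorphic_on D (fun x => g x 0 j).
    exact (holomorphic_sub DP (@holomorphic_pullback_point _ _ _ _ _ _ branchUd h j)).
  exact (holomorphic_comp oD DO holY hg).
split=> // x0 Dx0 [/= _ regx0].
have /choice[pq pqE] u : exists pq : mpoly (n + m) K * mpoly (n + m) K,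
    [/\ tower_poly T pq.2 != 0,
        mcoeff u F = tower_poly T pq.1 / tower_poly T pq.2 &
        meval (psi x0 0) pq.2 != 0].
  by have [_ [p [q [? ? ? _]]]] := regx0 u; exists (p, q).
(* Denominators regular at [x0] are kept fixed near it, so the coefficients become holomorphic
   quotients. Only the finitely many in the support are used, which keeps [W] open. *)
pose W := D `&` [set x | forall j : 'I_(size (msupp F)),
  meval (psi x 0) (pq (nth mnm0 (msupp F) j)).2 != 0].
have Wx0 : W x0 by split=> // j; have [] := pqE (nth mnm0 (msupp F) j).
have Wq x u : W x -> u \in msupp F -> meval (psi x 0) (pq u).2 != 0.
  move=> [_ Wx] uF; have iu : (index u (msupp F) < size (msupp F))%N.
    by rewrite index_mem.
  by have := Wx (Ordinal iu); rewrite /= nth_index.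
pose E := \prod_(u <- msupp F) (pq u).2.
have WE : W = [set x | D x /\ meval (psi x 0) E != 0].
  apply/seteqP; split=> x.
    move=> Wx; split; first by case: Wx.
    rewrite rmorph_prod prodf_seq_neq0; apply/allP => u uF.
    by apply/implyP => _; exact: Wq.
  move=> [Dx]; rewrite rmorph_prod prodf_seq_neq0 => /allP Ex; split=> // j.
  by have := Ex _ (mem_nth mnm0 (ltn_ord j)).
have DU x : D x -> U x by move=> /DP [].
have oW : open W.
  rewrite WE; apply: (open_preimage oD (@open_meval_neq0 _ _ E)) => x Dx.
  exact: (differentiable_tower_point branchUd (DU _ Dx)).
have WD : W `<=` D by move=> x [].
pose e x := \sum_(u <- msupp F) value (tower_poly T) (mcoeff u F) (psi x) *
  \prod_i jet (s := s) (Y \o g) x i ^+ u i.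
have val x u : W x -> u \in msupp F ->
    has_value (tower_poly T) (mcoeff u F) (psi x)
      (meval (psi x 0) (pq u).1 / meval (psi x 0) (pq u).2).
  move=> Wx uF; have [qu Fu _] := pqE u; exists (pq u).1, (pq u).2.
  by split=> //; exact: Wq.
have spec x : W x -> specializes (tower_poly T) (psi x).
  by move=> /WD/DU; exact: tower_point_specializes.
have hole : holomorphic_on W e.
  (* The redundant filter makes membership in the support available for each term. *)
  have -> : e = fun x => \sum_(u <- msupp F | u \in msupp F)
      value (tower_poly T) (mcoeff u F) (psi x) *
      \prod_i jet (s := s) (Y \o g) x i ^+ u i.
    by apply/funext => x; rewrite /e big_seq.
  apply: holomorphic_sum => // u uF; apply: holomorphicM => //; last first.
    apply: holomorphic_prod => // i; apply: holomorphicX => //.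
    exact: (holomorphic_sub WD (holomorphic_multi_iter _ holf)).
  pose quo (w : 'rV[K]_(n + m)) : K := meval (w 0) (pq u).1 / meval (w 0) (pq u).2.
  have hquo : holomorphic_on [set w : 'rV[K]_(n + m) | meval (w 0) (pq u).2 != 0] quo.
    apply: rational_on_holomorphic; first exact: open_meval_neq0.
    exists (rat_of_mpoly (pq u).1 / rat_of_mpoly (pq u).2) => w qw.
    exact: has_value_frac.
  have hpsi l : holomorphic_on W (fun x => psi x 0 l).
    by apply: (holomorphic_sub _ (holomorphic_tower_point branchUd l)) => x /WD/DU.
  apply: (eq_holomorphic oW _ (holomorphic_comp oW (fun x Wx => Wq x u Wx uF) hquo hpsi)).
  by move=> x Wx; rewrite (value_eq (spec x Wx) (val x u Wx uF)).
(* A residual nonzero at [x0] would be nonzero on an open set, which by density contains a point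
   where [Q] is regular at g(x); there the equation is already known. *)
have [//|ex0] := eqVneq (meval (jet (Y \o g) x0) (coeffs_value F (psi x0))) 0.
have [x [Wx ex] regx] : exists2 x, [set x | W x /\ e x != 0] x & ratmap_regular Q (g x).
  apply: (pullback_regular branchUd QV hQ).
  - by move=> x [/WD/DP].
  - exact: open_neq0.
  - by exists x0; split=> //; rewrite /e -meval_coeffs_value.
have regF : coeffs_regular F (psi x).
  move=> u; have [uF|uF] := boolP (u \in msupp F); first by eexists; exact: val.
  (* Outside the support the coefficient is 0, which is regular everywhere. *)
  rewrite memN_msupp_eq0 //; exists 0; exact: (transfer0 (tower_poly T) (meval (psi x 0))).
case/eqP: ex; rewrite /e -meval_coeffs_value.
have Dx : regular_pullback_dom U d Q h x by split=> //; exact/DP/WD.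
have Ox : Omega (g x) by case: (WD _ Wx).
exact (pdeA_regular_point branchUd hQ dK oOmega holY solB Dx Ox regF).
Qed.

End Solution.

Theorem corollary5p4 (R : realType) (n m s : nat)
    (T : radical_tower R[i] n m) (U : set 'rV[R[i]]_n)
    (d : 'rV[R[i]]_n -> 'rV[R[i]]_m) (branchUd : is_branch T U d)
    (F : diffpoly T n s) (unirT : unirational n (tower_variety U d)) :
  [/\ unirational n (radical_variety U d F),
      forall Q : 'I_(n + m) -> ratfun R[i] n,
        rational_parametrization (tower_variety U d) Q ->
        pde_algebraic (pdeB Q F)
    & forall (Q : 'I_(n + m) -> ratfun R[i] n) (h : 'I_n -> ratfun R[i] (n + m)),
        rational_parametrization (tower_variety U d) Q ->
        birational_inverse (tower_variety U d) Q h ->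
        forall (Omega : set 'rV[R[i]]_n) (Y : 'rV[R[i]]_n -> R[i]),
          pde_solution (pdeB Q F) Omega Y ->
          pde_solution (pdeA U d F)
            [set x | [/\ U x, ratmap_regular h (tower_point d x) &
                         Omega (ratmap_value h (tower_point d x))]]
            (fun x => Y (ratmap_value h (tower_point d x)))].
Proof.
split.
- exact (radical_variety_unirational branchUd F unirT).
- move=> Q QV; exact (pdeB_algebraic branchUd QV F).
- move=> Q h QV hQ Omega Y solB.
  exact (pullback_solution branchUd QV hQ (@complex_derivatives_commute R) solB).
Qed.
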